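(* Let $M(E,I)$ be a free partially commutative monoid with $E$ finite, let $n\ge 0$, and let $X_n^{\bullet}=\{x_0,x_1,\ldots,x_n,*\}$ be a right pointed $M(E,I)$-set with $n+2$ elements such that i) $M(E,I)$ acts fully over $X_n^{\bullet}$; ii) the graph $\mathscr{G}[M(E,I),X_n^{\bullet}]$ is a rooted tree with root $*$. Then for every $s\ge 1$ there is an isomorphism $$H_s(X_n^{\bullet};\mathbb{Z})\cong\left(\widetilde{H}_{s-1}((E,\mathfrak{M});\mathbb{Z})\right)^{n+1}\oplus\mathbb{Z}^{p_s},$$ where $p_s$ is the number of subsets $\{e_1,\ldots,e_s\}\subseteq E$ consisting of $s$ (distinct) mutually commuting generators, and $\widetilde{H}_{s-1}((E,\mathfrak{M});\mathbb{Z})$ is the reduced integral homology of the simplicial complex $(E,\mathfrak{M})$.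
   Context: Let $E$ be a finite set and $I\subseteq E\times E$ an irreflexive symmetric relation. The free partially commutative monoid $M(E,I)$ is the monoid given by generators $E$ and relations $ab=ba$ for all $(a,b)\in I$. Generators $a,b$ with $(a,b)\in I$ are called commuting generators; a subset of $E$ consists of mutually commuting generators if any two distinct elements of it form a pair in $I$. The simplicial complex (simplicial schema) $(E,\mathfrak{M})$ has vertex set $E$, and its simplices are the nonempty finite subsets of $E$ consisting of mutually commuting generators. A right pointed $M(E,I)$-set $X_n^{\bullet}$ is a pointed set $\{x_0,\ldots,x_n,*\}$ (with $n+2$ elements, base point $*$) with a right action of $M(E,I)$ by based maps, so $*\cdot\mu=*$ for all $\mu\in M(E,I)$. The category $\mathfrak{Cat}_*[X_n^{\bullet}]$ has as objects the elements of $X_n^{\bullet}$, and as morphisms $x\to x'$ the triples $(x,\mu,x')$ with $\mu\in M(E,I)$ and $x\cdot\mu=x'$; the composite of $(x,\mu,x')$ and $(x',\mu',x'')$ is $(x,\mu\mu',x'')$, and identities are $(x,1,x)$. For a small category $\mathscr{A}$ and a functor $F:\mathscr{A}\to\mathrm{Ab}$, $\varinjlim_s^{\mathscr{A}}F$ denotes the value at $F$ of the $s$-th left derived functor of $\varinjlim^{\mathscr{A}}:\mathrm{Ab}^{\mathscr{A}}\to\mathrm{Ab}$. $\Delta\mathbb{Z}$ is the constant functor with value $\mathbb{Z}$ (and identity maps on morphisms). The integral homology groups of $X_n^{\bullet}$ are $H_s(X_n^{\bullet};\mathbb{Z})=\varinjlim_s^{\mathfrak{Cat}_*[X_n^{\bullet}]}\Delta\mathbb{Z}$.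 The monoid $M(E,I)$ acts fully over $X_n^{\bullet}$ if $x\cdot e=x\cdot e'$ for every $x\in X_n^{\bullet}$ and all $e,e'\in E$. The graph $\mathscr{G}[M(E,I),X_n^{\bullet}]$ has node set $\{x_0,\ldots,x_n,*\}$ and one edge from a node $x$ to a node $y$ if and only if $x\cdot e=y$ for all $e\in E$, except that the loop at $*$ is removed. It is a rooted tree with root $*$ when it is a tree all of whose edges are directed towards $*$. *)

(* Defs.v *)
From HB Require Import structures.
Set Warnings "-notation-overridden,-ambiguous-paths".
Set Warnings "-redundant-canonical-projection,-projection-no-head-constant".
From mathcomp Require Import all_boot all_order all_algebra.
From mathcomp Require Import ring_quotient.
From mathcomp Require Import boolp.
From mathcomp Require Import freeg.
Set Warnings "notation-overridden,ambiguous-paths".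

Set Implicit Arguments.
Unset Strict Implicit.
Unset Printing Implicit Defensive.

Import GRing.Theory.
Local Open Scope ring_scope.
Local Open Scope quotient_scope.

Definition isomorphic (A B : zmodType) : Prop :=
  exists f : {additive A -> B}, bijective f.

Definition surjective (A B : Type) (f : A -> B) : Prop :=
  forall b, exists a, f a = b.

Section QuotientMap.
Variables (V : zmodType) (I : zmodClosed V).

Definition quot_pi : {additive V -> Quotient.quot I} := \pi_(Quotient.quot I).

Lemma quot_pi_eq x y : x - y \in I -> quot_pi x = quot_pi y.
Proof. by move=> xyI; apply/eqP; rewrite -Quotient.idealrBE. Qed.

Lemma quot_pi_surj : surjective quot_pi.
Proof. by move=> q; exists (repr q); rewrite /quot_pi /= reprK. Qed.
End QuotientMap.

Section QuotientLift.
Variables (V W : zmodType) (I : zmodClosed V) (f : {additive V -> W}).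

Definition quot_lift (fI : forall x, x \in I -> f x = 0) :
  Quotient.quot I -> W := fun q => f (repr q).

Hypothesis fI : forall x, x \in I -> f x = 0.

Lemma quot_lift_pi x : quot_lift fI (quot_pi I x) = f x.
Proof.
apply/eqP; rewrite -subr_eq0 -raddfB; apply/eqP/fI.
by rewrite Quotient.idealrBE reprK.
Qed.

Lemma quot_lift_is_additive : zmod_morphism (quot_lift fI).
Proof.
move=> x y; have [[a <-] [b <-]] := (quot_pi_surj x, quot_pi_surj y).
by rewrite -raddfB !quot_lift_pi raddfB.
Qed.

HB.instance Definition _ :=
  GRing.isZmodMorphism.Build _ _ (quot_lift fI) quot_lift_is_additive.
End QuotientLift.

Section GeneratedSubgroup.
Variables (V : zmodType) (S : V -> Prop).

Definition gen_subgroup : pred V := fun x =>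
  `[< forall H : zmodClosed V, (forall y, S y -> y \in H) -> x \in H >].

Lemma gen_subgroup_closed : zmod_closed gen_subgroup.
Proof.
split=> [|x y /asboolP Sx /asboolP Sy]; apply/asboolP => H SH.
  exact: rpred0.
by rewrite rpredB ?Sx ?Sy.
Qed.

HB.instance Definition _ :=
  GRing.isZmodClosed.Build V gen_subgroup gen_subgroup_closed.

Definition generated : zmodClosed V :=
  GRing.ZmodClosed.clone V gen_subgroup _.

Lemma mem_generated x : S x -> x \in generated.
Proof. by move=> Sx; apply/asboolP => H; apply. Qed.

Lemma generated_min (H : zmodClosed V) :
  (forall y, S y -> y \in H) -> forall x, x \in generated -> x \in H.
Proof. by move=> SH x /asboolP; apply. Qed.
End GeneratedSubgroup.

Section Kernel.
Variables (V W : zmodType) (f : {additive V -> W}).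

Definition in_kernel : pred V := fun x => f x == 0.

Lemma in_kernel_closed : zmod_closed in_kernel.
Proof.
split=> [|x y]; rewrite unfold_in; first by rewrite raddf0.
by move=> /eqP fx /eqP fy; rewrite unfold_in raddfB fx fy subr0.
Qed.

HB.instance Definition _ :=
  GRing.isZmodClosed.Build V in_kernel in_kernel_closed.

Record kernel := Kernel { kernel_val : V; _ : in_kernel kernel_val }.

HB.instance Definition _ := [isSub for kernel_val].
HB.instance Definition _ := [Choice of kernel by <:].
HB.instance Definition _ := [SubChoice_isSubZmodule of kernel by <:].

Lemma kernelP (x : kernel) : f (val x) = 0.
Proof. exact/eqP/(valP x). Qed.
End Kernel.

Definition freeab (T : Type) : zmodType := {freeg {classic T} / int}.

Definition fgen (T : Type) (x : T) : freeab T := << (x : {classic T}) >>.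

Section FreeLift.
Variables (T : Type) (W : zmodType) (f : T -> W).

Definition free_lift : freeab T -> W :=
  @fglift int (zmodule W) {classic T} f.

Lemma free_lift_is_additive : zmod_morphism free_lift.
Proof. exact: (@lift_is_additive int {classic T} (zmodule W) f). Qed.

HB.instance Definition _ :=
  GRing.isZmodMorphism.Build (freeab T) W free_lift free_lift_is_additive.

Lemma free_lift_gen x : free_lift (fgen x) = f x.
Proof. by rewrite /free_lift liftU scalezrE. Qed.
End FreeLift.

Lemma freeab_ext (T : Type) (W : zmodType) (f g : {additive freeab T -> W}) :
  (forall x, f (fgen x) = g (fgen x)) -> f =1 g.
Proof.
move=> fg; elim/freeg_ind_dom0 => [|k x D _ _ IH]; first by rewrite !raddf0.
rewrite !raddfD IH; congr (_ + _).
have -> : << k *g x >> = (fgen x : freeab T) *~ k.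
  by rewrite /fgen freegU_mulz intz.
by rewrite !raddfMz fg.
Qed.

Record chain_complex := ChainComplex {
  chain :> nat -> zmodType;
  bd : forall k, {additive chain k.+1 -> chain k};
  bdbd : forall k x, bd k (bd k.+1 x) = 0
}.

Section Homology.
Variable C : chain_complex.

Definition bd_out (k : nat) : {additive C k -> C k.-1} :=
  match k with
  | 0 => @GRing.null_fun (C 0%N) (C 0%N)
  | k'.+1 => bd C k'
  end.

Variable k : nat.

Definition cycles : zmodType := kernel (bd_out k).

Definition is_boundary : pred cycles := fun z =>
  `[< exists y : C k.+1, bd C k y = val z >].

Lemma is_boundary_closed : zmod_closed is_boundary.
Proof.
split=> [|x y /asboolP[a ax] /asboolP[b bx]]; apply/asboolP.
  by exists 0; rewrite !raddf0.
by exists (a - b); rewrite !raddfB ax bx.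
Qed.

HB.instance Definition _ :=
  GRing.isZmodClosed.Build cycles is_boundary is_boundary_closed.

Definition boundaries : zmodClosed cycles :=
  GRing.ZmodClosed.clone cycles is_boundary _.

Definition homology : zmodType := Quotient.quot boundaries.
End Homology.

(* Composition is written in diagrammatic order. *)
Record category := Category {
  ob :> Type;
  hom : ob -> ob -> Type;
  idm : forall a, hom a a;
  comp : forall a b c, hom a b -> hom b c -> hom a c;
  comp1m : forall a b (f : hom a b), comp (idm a) f = f;
  compm1 : forall a b (f : hom a b), comp f (idm b) = f;
  compA : forall a b c d (f : hom a b) (g : hom b c) (h : hom c d),
    comp f (comp g h) = comp (comp f g) h
}.
Arguments idm {c0} a : rename.
Arguments comp {c0 a b c} f g : rename.

Record functor (A : category) := Functor {
  fob :> A -> zmodType;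
  fmap : forall a b, hom a b -> {additive fob a -> fob b};
  fmap1 : forall a x, fmap (idm a) x = x;
  fmapM : forall a b c (f : hom a b) (g : hom b c) x,
    fmap (comp f g) x = fmap g (fmap f x)
}.
Arguments fmap {A} F {a b} f : rename.

Record natural (A : category) (F G : functor A) := Natural {
  ncomp :> forall a, {additive F a -> G a};
  nat_comm : forall a b (f : hom a b) x,
    ncomp b (fmap F f x) = fmap G f (ncomp a x)
}.

Section ConstantFunctor.
Variables (A : category) (V : zmodType).

Definition const_functor : functor A :=
  @Functor A (fun _ => V) (fun _ _ _ => @idfun V : {additive V -> V})
    (fun _ _ => erefl) (fun _ _ _ _ _ _ => erefl).
End ConstantFunctor.

Section Colimit.
Variables (A : category) (F : functor A).

Let el := {a : A & F a}.
Let elt (a : A) (x : F a) : freeab el := fgen (existT (fun a => F a) a x).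

(* The colimit is the abelian group presented by generators [a, x], a an object
   and x in F a, additive in x and such that [b, F f x] = [a, x] for f : a -> b.
   Its universal property is given by the lemmas below. *)
Inductive colim_relator : freeab el -> Prop :=
| RelAdd a (x y : F a) : colim_relator (elt (x + y) - elt x - elt y)
| RelMap a b (f : hom a b) (x : F a) :
    colim_relator (elt (fmap F f x) - elt x).

Definition colim : zmodType := Quotient.quot (generated colim_relator).

Definition colim_in (a : A) (x : F a) : colim :=
  quot_pi (generated colim_relator) (elt x).

Lemma colim_in_is_additive a : zmod_morphism (@colim_in a).
Proof.
have addE (x y : F a) : colim_in (x + y) = colim_in x + colim_in y.
  rewrite /colim_in -raddfD; apply: quot_pi_eq; rewrite opprD addrA.
  exact/mem_generated/RelAdd.
by move=> x y; apply/eqP; rewrite -subr_eq opprK -addE subrK.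
Qed.

HB.instance Definition _ (a : A) :=
  GRing.isZmodMorphism.Build (F a) colim (@colim_in a)
    (colim_in_is_additive (a := a)).

Lemma colim_in_comm a b (f : hom a b) (x : F a) :
  colim_in (fmap F f x) = colim_in x.
Proof.
exact/quot_pi_eq/mem_generated/RelMap.
Qed.

Section Descent.
Variables (W : zmodType) (g : forall a, {additive F a -> W}).
Hypothesis g_comm : forall a b (f : hom a b) x, g b (fmap F f x) = g a x.

Let pre_desc : {additive freeab el -> W} :=
  free_lift (fun u : el => g (projT1 u) (projT2 u)).

Lemma pre_desc_elt a (x : F a) : pre_desc (elt x) = g a x.
Proof. exact: free_lift_gen. Qed.

Lemma pre_desc_relator x :
  x \in generated colim_relator -> pre_desc x = 0.
Proof.
move=> xR; apply/eqP; apply: (generated_min (H := GRing.ZmodClosed.clone _ (in_kernel pre_desc) _) _ xR).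
move=> {x xR} _ [a x y|a b f x]; rewrite unfold_in.
  by rewrite !raddfB !pre_desc_elt raddfD addrAC addrK subrr.
by rewrite raddfB !pre_desc_elt g_comm subrr.
Qed.

Definition colim_desc : {additive colim -> W} := quot_lift pre_desc_relator.

Lemma colim_desc_in a (x : F a) : colim_desc (colim_in x) = g a x.
Proof. by rewrite [LHS]quot_lift_pi pre_desc_elt. Qed.
End Descent.

Lemma colim_ext (W : zmodType) (h h' : {additive colim -> W}) :
  (forall a (x : F a), h (colim_in x) = h' (colim_in x)) -> h =1 h'.
Proof.
move=> hh' q; have [{q}r <-] := quot_pi_surj q.
pose p : {additive freeab el -> colim} := quot_pi (generated colim_relator).
move: r; apply: (@freeab_ext el W (h \o p) (h' \o p)) => -[a x]; exact: hh'.
Qed.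
End Colimit.

Section ColimitMap.
Variables (A : category) (F G : functor A) (t : natural F G).

Lemma colim_map_comm a b (f : hom a b) (x : F a) :
  (@colim_in A G b \o t b) (fmap F f x) = (@colim_in A G a \o t a) x.
Proof. by rewrite /= nat_comm colim_in_comm. Qed.

Definition colim_map : {additive colim F -> colim G} :=
  colim_desc (g := fun a => @colim_in A G a \o t a) colim_map_comm.

Lemma colim_map_in a (x : F a) : colim_map (colim_in x) = colim_in (t a x).
Proof. exact: colim_desc_in. Qed.
End ColimitMap.

(* Epimorphisms, kernels and exactness in the abelian category Ab^A are
   computed objectwise. *)
Definition projective (A : category) (P : functor A) : Prop :=
  forall (G H : functor A) (p : natural G H) (t : natural P H),
    (forall a, surjective (p a)) ->
    exists u : natural P G, forall a x, p a (u a x) = t a x.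

Record projective_resolution (A : category) (F : functor A) := Resolution {
  res :> nat -> functor A;
  res_d : forall k, natural (res k.+1) (res k);
  res_aug : natural (res 0%N) F;
  res_proj : forall k, projective (res k);
  res_aug_surj : forall a, surjective (res_aug a);
  res_exact0 : forall a (x : res 0%N a),
    res_aug a x = 0 <-> exists y, res_d 0%N a y = x;
  res_exact : forall k a (x : res k.+1 a),
    res_d k a x = 0 <-> exists y, res_d k.+1 a y = x
}.

Section DerivedColimit.
Variables (A : category) (F : functor A) (P : projective_resolution F).

Lemma colim_res_dd k (x : colim (P k.+2)) :
  colim_map (res_d P k) (colim_map (res_d P k.+1) x) = 0.
Proof.
pose h : {additive colim (P k.+2) -> colim (P k)} :=
  colim_map (res_d P k) \o colim_map (res_d P k.+1).
pose z : {additive colim (P k.+2) -> colim (P k)} :=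
  @GRing.null_fun (colim (P k.+2)) (colim (P k)).
apply: (@colim_ext A (P k.+2) _ h z) => a y.
rewrite -[LHS]/(colim_map (res_d P k) (colim_map (res_d P k.+1) (colim_in y))).
rewrite !colim_map_in.
have -> : res_d P k a (res_d P k.+1 a y) = 0 by apply/res_exact; exists y.
by rewrite raddf0.
Qed.

Definition colim_complex : chain_complex :=
  ChainComplex (bd := fun k => colim_map (res_d P k)) colim_res_dd.

(* The value at F of the s-th left derived functor of the colimit, computed by
   the projective resolution P of F.  Resolutions exist by Lemma
   projective_resolution_exists below. *)
Definition derived_colim (s : nat) : zmodType := homology colim_complex s.
End DerivedColimit.

Section KernelFunctor.
Variables (A : category) (F G : functor A) (t : natural F G).

Lemma ker_fmap_subproof a b (f : hom a b) (x : kernel (t a)) :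
  in_kernel (t b) (fmap F f (val x)).
Proof. by rewrite /in_kernel nat_comm kernelP raddf0. Qed.

Definition ker_fmap a b (f : hom a b) (x : kernel (t a)) : kernel (t b) :=
  Sub (fmap F f (val x)) (ker_fmap_subproof f x).

Lemma ker_fmap_is_additive a b (f : hom a b) : zmod_morphism (ker_fmap f).
Proof. by move=> x y; apply: val_inj; rewrite raddfB /= !raddfB. Qed.

HB.instance Definition _ a b (f : hom a b) :=
  GRing.isZmodMorphism.Build _ _ (ker_fmap f) (ker_fmap_is_additive f).

Program Definition ker_functor : functor A :=
  @Functor A (fun a => kernel (t a)) (fun a b f => ker_fmap f) _ _.
Next Obligation. by apply: val_inj; rewrite /= fmap1. Qed.
Next Obligation. by apply: val_inj; rewrite /= fmapM. Qed.

Program Definition ker_incl : natural ker_functor F :=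
  @Natural A ker_functor F (fun a => val : {additive kernel (t a) -> F a}) _.
End KernelFunctor.

Section FreeCover.
Variables (A : category) (F : functor A).

Let gens (a : A) : Type := {b : A & (F b * hom b a)%type}.
Let mkg (a b : A) (x : F b) (g : hom b a) : gens a :=
  existT (fun b => (F b * hom b a)%type) b (x, g).

Definition cover_map (a a' : A) (f : hom a a') :
  {additive freeab (gens a) -> freeab (gens a')} :=
  free_lift (fun u => fgen (mkg (projT2 u).1 (comp (projT2 u).2 f))).

Lemma cover_map_gen a a' (f : hom a a') b (x : F b) (g : hom b a) :
  cover_map f (fgen (mkg x g)) = fgen (mkg x (comp g f)).
Proof. exact: free_lift_gen. Qed.

Program Definition cover : functor A :=
  @Functor A (fun a => freeab (gens a)) cover_map _ _.
Next Obligation.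
move: x; apply: (freeab_ext (f := cover_map (idm a)) (g := idfun)).
by case=> b [x g]; rewrite cover_map_gen compm1.
Qed.
Next Obligation.
move: x; apply: (freeab_ext (f := cover_map _) (g := cover_map g \o cover_map f)).
by case=> d [x h]; rewrite /= !cover_map_gen compA.
Qed.

Definition cover_aug_comp (a : A) : {additive cover a -> F a} :=
  free_lift (fun u : gens a => fmap F (projT2 u).2 (projT2 u).1).

Lemma cover_aug_gen a b (x : F b) (g : hom b a) :
  cover_aug_comp a (fgen (mkg x g)) = fmap F g x.
Proof. exact: free_lift_gen. Qed.

Program Definition cover_aug : natural cover F := @Natural A cover F cover_aug_comp _.
Next Obligation.
move: x; apply: (freeab_ext (f := cover_aug_comp b \o cover_map f)
                            (g := fmap F f \o cover_aug_comp a)).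
by case=> d [x h]; rewrite /= cover_map_gen !cover_aug_gen fmapM.
Qed.

Lemma cover_aug_surj a : surjective (cover_aug a).
Proof.
by move=> x; exists (fgen (mkg x (idm a))); rewrite [LHS]cover_aug_gen fmap1.
Qed.

Lemma cover_projective : projective cover.
Proof.
move=> G H p t p_surj.
have lift_ex (u : {b : A & F b}) :
    exists y : G (projT1 u), p _ y = t _ (fgen (mkg (projT2 u) (idm (projT1 u)))).
  exact: p_surj.
pose l b (x : F b) : G b := sval (cid (lift_ex (existT (fun b => F b) b x))).
have lE b (x : F b) : p b (l b x) = t b (fgen (mkg x (idm b))).
  exact: (svalP (cid (lift_ex (existT (fun b => F b) b x)))).
pose v a : {additive cover a -> G a} :=
  free_lift (fun u : gens a => fmap G (projT2 u).2 (l _ (projT2 u).1)).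
have vE a b (x : F b) (g : hom b a) : v a (fgen (mkg x g)) = fmap G g (l b x).
  exact: free_lift_gen.
have v_nat a b (f : hom a b) x : v b (fmap cover f x) = fmap G f (v a x).
  move: x; apply: (freeab_ext (f := v b \o cover_map f) (g := fmap G f \o v a)).
  by case=> d [x h]; rewrite /= cover_map_gen !vE fmapM.
exists (Natural v_nat) => a x /=; move: x.
apply: (freeab_ext (f := p a \o v a) (g := t a)).
case=> d [x h]; rewrite /= vE nat_comm lE -nat_comm.
by rewrite [fmap cover h _]cover_map_gen comp1m.
Qed.
End FreeCover.

Section CanonicalResolution.
Variables (A : category) (F : functor A).

Fixpoint syzygy (k : nat) : functor A :=
  if k is k'.+1 then ker_functor (cover_aug (syzygy k')) else F.

Program Definition std_d (k : nat) :
  natural (cover (syzygy k.+1)) (cover (syzygy k)) :=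
  @Natural A _ _
   (fun a => ker_incl (cover_aug (syzygy k)) a \o cover_aug (syzygy k.+1) a) _.
Next Obligation.
exact: (congr1 val (nat_comm (cover_aug (syzygy k.+1)) f x)).
Qed.

Lemma projective_resolution_exists : inhabited (projective_resolution F).
Proof.
have exact_at k a (x : cover (syzygy k) a) :
    cover_aug (syzygy k) a x = 0 <-> exists y, std_d k a y = x.
  split=> [x0|[y <-]]; last exact: kernelP.
  have xK : in_kernel (cover_aug (syzygy k) a) x by apply/eqP.
  have [y yx] := cover_aug_surj (F := syzygy k.+1) (Kernel xK).
  by exists y; rewrite /= yx.
constructor; apply: (@Resolution A F (fun k => cover (syzygy k)) std_d (cover_aug F)).
- by move=> k; apply: cover_projective.
- exact: cover_aug_surj.
- exact: (exact_at 0%N).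
- move=> k a x; rewrite -exact_at; split=> [x0|x0].
    by apply: val_inj; rewrite [LHS]x0.
  by rewrite /= x0.
Qed.
End CanonicalResolution.

Section TraceMonoid.
Variables (E : finType) (I : rel E).

Inductive trace_eq : seq E -> seq E -> Prop :=
| TraceComm a b : I a b -> trace_eq [:: a; b] [:: b; a]
| TraceCat u u' v v' :
    trace_eq u u' -> trace_eq v v' -> trace_eq (u ++ v) (u' ++ v')
| TraceRefl u : trace_eq u u
| TraceSym u v : trace_eq u v -> trace_eq v u
| TraceTrans u v w : trace_eq u v -> trace_eq v w -> trace_eq u w.

Definition trace_eqb : rel (seq E) := fun u v => `[< trace_eq u v >].

Lemma trace_eqb_equiv : equiv_class_of trace_eqb.
Proof.
split=> [u|u v|v u w]; first exact/asboolP/TraceRefl.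
  by apply/asboolP/asboolP => ?; apply: TraceSym.
by move=> /asboolP uv /asboolP vw; apply/asboolP/(TraceTrans uv vw).
Qed.

Canonical trace_equiv := EquivRelPack trace_eqb_equiv.
Canonical trace_encModRel := defaultEncModRel trace_eqb.

Definition trace_monoid := {eq_quot trace_eqb}.

HB.instance Definition _ := Choice.on trace_monoid.

Definition trace_class (u : seq E) : trace_monoid := \pi u.

Lemma trace_classP u v : trace_class u = trace_class v <-> trace_eq u v.
Proof.
rewrite /trace_class; split=> [/eqP|uv].
  by rewrite piE => /asboolP.
by apply/eqP; rewrite piE; apply/asboolP.
Qed.

Definition trace_one : trace_monoid := trace_class [::].
Definition trace_mul (x y : trace_monoid) : trace_monoid :=
  trace_class (repr x ++ repr y).

Lemma trace_repr u : trace_eq (repr (trace_class u)) u.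
Proof. by apply/trace_classP; rewrite /trace_class reprK. Qed.

Lemma trace_classM u v :
  trace_mul (trace_class u) (trace_class v) = trace_class (u ++ v).
Proof. by apply/trace_classP; apply: TraceCat; apply: trace_repr. Qed.

Lemma trace_mulA : associative trace_mul.
Proof.
move=> x y z; rewrite -[x]reprK -[y]reprK -[z]reprK -!/(trace_class _).
by rewrite !trace_classM catA.
Qed.

Lemma trace_mul1 : left_id trace_one trace_mul.
Proof. by move=> x; rewrite -[x]reprK -!/(trace_class _) trace_classM. Qed.

Lemma trace_mulr1 : right_id trace_one trace_mul.
Proof.
by move=> x; rewrite -[x]reprK -!/(trace_class _) trace_classM cats0.
Qed.

HB.instance Definition _ :=
  isMonoid.Build trace_monoid trace_mulA trace_mul1 trace_mulr1.

Definition tgen (e : E) : trace_monoid := trace_class [:: e].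

Definition commuting (A : {set E}) : bool :=
  [forall a in A, forall b in A, (a != b) ==> I a b].
End TraceMonoid.

Record pointed_action (M : monoidType) (X : Type) (pt : X) := PointedAction {
  act :> X -> M -> X;
  act1 : forall x, act x 1%g = x;
  actM : forall x m m', act x (m * m')%g = act (act x m) m';
  act_pt : forall m, act pt m = pt
}.

Section ActionCategory.
Variables (M : monoidType) (X : eqType) (pt : X) (a : pointed_action M pt).

Record act_hom (x x' : X) := ActHom {
  act_elt : M;
  act_eltP : a x act_elt = x'
}.

Lemma act_hom_eq x x' (f g : act_hom x x') : act_elt f = act_elt g -> f = g.
Proof.
case: f g => [m p] [m' p'] /= mm'; case: m' / mm' p' => p'.
by rewrite (eq_irrelevance p p').
Qed.

Definition act_id x : act_hom x x := ActHom (act1 a x).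

Lemma act_compP x y z (f : act_hom x y) (g : act_hom y z) :
  a x (act_elt f * act_elt g)%g = z.
Proof. by rewrite actM !act_eltP. Qed.

Definition act_comp x y z (f : act_hom x y) (g : act_hom y z) : act_hom x z :=
  ActHom (act_compP f g).

Program Definition act_category : category :=
  @Category X act_hom act_id act_comp _ _ _.
Next Obligation. by apply: act_hom_eq; rewrite /= mul1g. Qed.
Next Obligation. by apply: act_hom_eq; rewrite /= mulg1. Qed.
Next Obligation. by apply: act_hom_eq; rewrite /= mulgA. Qed.

(* The integral homology group H_s(X; Z). *)
Definition pset_homology
    (P : projective_resolution (const_functor act_category int)) (s : nat) :
  zmodType := derived_colim P s.
End ActionCategory.

Section ActionGraph.
Variables (E : finType) (I : rel E) (X : finType) (pt : X).
Variable a : pointed_action (trace_monoid I) pt.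

Definition acts_fully : Prop :=
  forall (x : X) (e e' : E), a x (tgen I e) = a x (tgen I e').

Definition action_graph : rel X := fun x y =>
  [forall e : E, a x (tgen I e) == y] && ~~ ((x == pt) && (y == pt)).
End ActionGraph.

Section RootedTree.
Variable T : finType.

(* Undirected graphs are symmetric relations.  A loop or a cycle through at
   least three distinct nodes is excluded; a closed walk x, y, x along a single
   edge is not a cycle. *)
Definition is_tree (g : rel T) : Prop :=
  [/\ symmetric g, irreflexive g, forall x y, connect g x y &
      forall c : seq T, ucycle g c -> (size c <= 2)%N].

(* In a tree, the path from x to r is unique; the edge x -> y is directed
   towards r when this path starts with it.  This forbids antiparallel edges. *)
Definition is_rooted_tree (e : rel T) (r : T) : Prop :=
  let u : rel T := fun x y => e x y || e y x in
  is_tree u /\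
  (forall x y, e x y ->
     exists p : seq T, [/\ path u x (y :: p), uniq [:: x, y & p] & last y p = r]).
End RootedTree.

Record simplicial_complex (V : finType) := SimplicialComplex {
  simplex :> pred {set V};
  simplex_neq0 : forall A, simplex A -> A != set0;
  simplex1 : forall v, simplex [set v];
  simplex_sub : forall A B : {set V}, simplex A -> B \subset A -> B != set0 -> simplex B
}.

Section ReducedHomology.
Variables (V : finType) (K : simplicial_complex V).

(* The empty set is added as the unique simplex of dimension -1. *)
Definition face (k : nat) : pred {set V} := fun A =>
  ((A == set0) || K A) && (#|A| == k).

(* Simplices are oriented by the enumeration order of V. *)
Definition position (A : {set V}) (v : V) : nat :=
  #|[set w in A | (enum_rank w < enum_rank v)%N]|.

(* The coefficient of B in the boundary of A. *)
Definition incidence (A B : {set V}) : int :=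
  \sum_(v in A | A :\ v == B) (-1) ^+ position A v.

(* Augmented chains, shifted by one: degree k is spanned by the simplices with
   k vertices, i.e. of dimension k - 1. *)
Definition aug_chain (k : nat) : zmodType := {ffun {A : {set V} | face k A} -> int}.

Definition aug_bd (k : nat) (c : aug_chain k.+1) : aug_chain k :=
  [ffun B : {B : {set V} | face k B} =>
     \sum_(A : {A : {set V} | face k.+1 A}) incidence (val A) (val B) * c A].

Lemma aug_bd_is_additive k : zmod_morphism (@aug_bd k).
Proof.
move=> c c'; apply/ffunP => B; rewrite !ffunE -sumrB.
by apply: eq_bigr => A _; rewrite !ffunE mulrBr.
Qed.

HB.instance Definition _ k :=
  GRing.isZmodMorphism.Build (aug_chain k.+1) (aug_chain k) (@aug_bd k)
    (@aug_bd_is_additive k).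

Lemma face_sub k (A : {set V}) v : face k.+1 A -> v \in A -> face k (A :\ v).
Proof.
case/andP => FA /eqP cA vA; apply/andP; split; last first.
  by move: (cardsD1 v A); rewrite vA cA add1n => -[->].
case: eqP => //= /eqP A0; case/orP: FA => [/eqP A0'|KA].
  by move: vA; rewrite A0' inE.
by apply: simplex_sub KA _ A0; rewrite subD1set.
Qed.

Lemma position_remove (A : {set V}) v w : v \in A ->
  position A w = ((enum_rank v < enum_rank w)%N + position (A :\ v) w)%N.
Proof.
move=> vA; rewrite /position (cardsD1 v) !inE vA /=; congr (_ + _)%N.
by apply: eq_card => u; rewrite !inE andbA.
Qed.

Lemma incidence_incidence k (A : {set V}) (B : {set V}) : face k.+2 A ->
  \sum_(C : {C : {set V} | face k.+1 C}) incidence A (val C) * incidence (val C) B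
    = 0.
Proof.
move=> FA.
pose f v w : int := if [&& v \in A, w \in A :\ v & A :\ v :\ w == B] then
  (-1) ^+ position A v * (-1) ^+ position (A :\ v) w else 0.
have fN v w : f v w = - f w v.
  rewrite /f !inE; have [vA|_] := boolP (v \in A); last by rewrite !andbF oppr0.
  have [wA|_] := boolP (w \in A); last by rewrite !andbF oppr0.
  have [->|vw] := eqVneq v w; first by rewrite /= oppr0.
  rewrite /=.
  have -> : A :\ w :\ v = A :\ v :\ w by rewrite !setDDl setUC.
  case: ifP => _; last by rewrite oppr0.
  rewrite (position_remove v wA) (position_remove w vA) !exprD.
  have /negPf rvw : enum_rank v != enum_rank w :> nat.
    by apply: contra vw => /eqP/val_inj/enum_rank_inj/eqP.
  case: ltngtP rvw => //= _ _; rewrite expr1 expr0.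
  - by rewrite !(mul1r, mulN1r, mulrN, mulNr, opprK) mulrC.
  - by rewrite !(mul1r, mulN1r, mulrN, mulNr, opprK) mulrC.
transitivity (\sum_v \sum_w f v w); last first.
  pose S := \sum_v \sum_w f v w; rewrite -/S.
  suff SS : S + S = 0 by apply/eqP; move/eqP: SS; rewrite -mulr2n Num.Theory.mulrn_eq0.
  rewrite {1}/S exchange_big -big_split big1 // => v _ /=.
  by rewrite -big_split /= big1 // => w _; rewrite fN addNr.
under eq_bigr do rewrite /incidence mulr_suml.
rewrite [RHS](bigID (mem A)) /= [X in _ = _ + X]big1 ?addr0; last first.
  by move=> v vA; rewrite big1 // => w _; rewrite /f ifN //= negb_and vA.
rewrite (exchange_big_dep (mem A)) /=; last by move=> C v _ /andP[].
apply: eq_bigr => v vA.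
have FAv := face_sub FA vA.
rewrite (big_pred1 (Sub (A :\ v) FAv)) /=; last first.
  by move=> C /=; rewrite vA /= eq_sym -val_eqE.
rewrite mulr_sumr /f big_mkcond /=; apply: eq_bigr => w _.
by rewrite vA.
Qed.

Lemma aug_bdbd k (c : aug_chain k.+2) : aug_bd (aug_bd c) = 0.
Proof.
apply/ffunP => B; rewrite !ffunE.
under eq_bigr => C _ do rewrite ffunE mulr_sumr.
rewrite exchange_big big1 // => A _ /=.
under eq_bigr => C _ do rewrite mulrA [_ * incidence _ _]mulrC.
by rewrite -mulr_suml incidence_incidence ?mul0r //; apply: valP.
Qed.

Definition aug_complex : chain_complex :=
  ChainComplex (bd := fun k => @aug_bd k : {additive _ -> _}) aug_bdbd.

(* The reduced homology in dimension k; note the shift in aug_complex. *)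
Definition reduced_homology (k : nat) : zmodType := homology aug_complex k.+1.
End ReducedHomology.

Section CommutingComplex.
Variables (E : finType) (I : rel E).

Definition commuting_simplex : pred {set E} := fun A =>
  (A != set0) && commuting I A.

Lemma commuting_simplex_neq0 A : commuting_simplex A -> A != set0.
Proof. by case/andP. Qed.

Lemma commuting_simplex1 v : commuting_simplex [set v].
Proof.
apply/andP; split; first by apply/set0Pn; exists v; rewrite inE.
apply/forall_inP => a /set1P ->; apply/forall_inP => b /set1P ->.
by rewrite eqxx.
Qed.

Lemma commuting_simplex_sub (A B : {set E}) :
  commuting_simplex A -> B \subset A -> B != set0 -> commuting_simplex B.
Proof.
case/andP => _ cA /subsetP BA B0; apply/andP; split=> //.
apply/forall_inP => a /BA aA; apply/forall_inP => b /BA bA.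
by move/forall_inP: cA => /(_ a aA) /forall_inP/(_ b bA).
Qed.

Definition commuting_complex : simplicial_complex E :=
  SimplicialComplex commuting_simplex_neq0 commuting_simplex1
    commuting_simplex_sub.

Definition num_commuting (s : nat) : nat :=
  #|[set A : {set E} | (#|A| == s) && commuting I A]|.
End CommutingComplex.

(* Main.v *)
(** The homology is computed from an explicit free resolution of the constant
    functor.  Its cells over [x] are the triples [(y, A, m)] with [A] a set of [s]
    mutually commuting generators and [y.[A].m = x], and its boundary is the cubical
    one: [(y, A, m)] goes to the alternating sum over [v] in [A] of
    [(y.v, A - v, m) - (y, A - v, v m)].  Exactness comes from pushing the first
    letter of the word [[A]m] from [m] into [A]: up to cells with a shorter total
    word, this contracts the complex, and one concludes by induction on the length.

    The colimit of this resolution is [Z[X] (x) C], where [C] is the augmented chain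
    complex of [(E, M)].  All generators act by one map [f], so the differential is
    [(f - 1) (x) bd].  In the rooted tree every node reaches the root under
    iteration of [f], so [f] is nilpotent, and [f - 1] invertible, on the functions
    of total mass zero (rank [n + 1]); and [Z[X]] is the direct sum of these and of
    the functions supported at the root, which [f - 1] kills.  The first summand
    contributes [n + 1] copies of the homology of [C], the second contributes [C_s]
    itself, with zero differential. *)

Require Import Defs.
From HB Require Import structures.
Set Warnings "-notation-overridden,-ambiguous-paths".
From mathcomp Require Import all_boot all_order all_algebra.
From mathcomp Require Import ring_quotient boolp freeg.
Set Warnings "notation-overridden,ambiguous-paths".

Set Implicit Arguments.
Unset Strict Implicit.
Unset Printing Implicit Defensive.

Import GRing.Theory.
Local Open Scope ring_scope.

(** * Comparison of projective resolutions *)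

Lemma inj_surj_bij (A B : zmodType) (f : {additive A -> B}) :
  (forall x, f x = 0 -> x = 0) -> surjective f -> bijective f.
Proof.
move=> f0 fS; pose g b := sval (cid (fS b)).
have gK : cancel g f by move=> b; rewrite /g; case: cid.
exists g => // x; apply/eqP; rewrite -subr_eq0; apply/eqP/f0.
by rewrite raddfB gK subrr.
Qed.

Lemma isomorphic_trans (A B C : zmodType) :
  isomorphic A B -> isomorphic B C -> isomorphic A C.
Proof. by move=> [f fb] [g gb]; exists (g \o f); apply: bij_comp. Qed.

(** Differences and [0] already give opposites, sums and integer multiples. Additive identities are
    thereby checked on generators. *)
Lemma freeab_ind (T : Type) (S : freeab T -> Prop) :
  S 0 -> (forall x, S (fgen x)) -> (forall x y, S x -> S y -> S (x - y)) ->
  forall x, S x.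
Proof.
move=> S0 Sg SB.
have SN x : S x -> S (- x) by move=> Sx; rewrite -[- x]add0r; apply: SB.
have SD x y : S x -> S y -> S (x + y).
  by move=> Sx Sy; rewrite -[y]opprK; apply/SB/SN.
have SM x k : S x -> S (x *~ k).
  move=> Sx; have Sn n : S (x *+ n).
    by elim: n => [|n IH]; rewrite ?mulr0n // mulrSr; apply: SD.
  by case: k => n; rewrite ?NegzE ?mulrNz -pmulrn //; apply: SN.
elim/freeg_ind_dom0 => [//|k x D _ _ IH]; apply: SD => //.
have -> : << k *g x >> = (fgen x : freeab T) *~ k.
  by rewrite /fgen freegU_mulz intz.
exact/SM/Sg.
Qed.

Lemma colim_ind (A : category) (F : functor A) (S : colim F -> Prop) :
  S 0 -> (forall a (x : F a), S (colim_in x)) ->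
  (forall x y, S x -> S y -> S (x - y)) -> forall x, S x.
Proof.
move=> S0 Sg SB q; have [{q}r <-] := quot_pi_surj q.
elim/freeab_ind: r => [|[a x]|x y Sx Sy]; first by rewrite raddf0.
  exact: Sg.
by rewrite raddfB; apply: SB.
Qed.

Lemma homology_isomorphic (C : chain_complex) (k : nat) (W : zmodType)
    (f : {additive cycles C k -> W}) :
  surjective f -> (forall z, f z = 0 <-> exists y, bd C k y = val z) ->
  isomorphic (homology C k) W.
Proof.
move=> fS fK.
have f0 z : z \in boundaries C k -> f z = 0 by move=> /asboolP/fK.
exists (quot_lift f0 : {additive _ -> _}); apply: inj_surj_bij => [q|w].
  have [z <-] := quot_pi_surj q; rewrite [LHS](quot_lift_pi f0) => fz.
  rewrite -(raddf0 (quot_pi (boundaries C k))); apply: quot_pi_eq.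
  by rewrite subr0; apply/asboolP/fK.
have [z <-] := fS w.
by exists (quot_pi (boundaries C k) z); apply: quot_lift_pi.
Qed.

Lemma homology_class0 (C : chain_complex) (k : nat) (z : cycles C k) :
  quot_pi (boundaries C k) z = 0 <-> exists y, bd C k y = val z.
Proof.
rewrite -(raddf0 (quot_pi (boundaries C k))); split=> [/eqP|bz].
  by rewrite -Quotient.idealrBE subr0 => /asboolP.
by apply: quot_pi_eq; rewrite subr0; apply/asboolP.
Qed.

Lemma bd_out_comm (C D : chain_complex) (f : forall k, {additive C k -> D k}) :
  (forall k x, f k (bd C k x) = bd D k (f k.+1 x)) ->
  forall k x, f k.-1 (bd_out C k x) = bd_out D k (f k x).
Proof. by move=> fd [|k] x //; apply: raddf0. Qed.

(** Homotopies matter only through their effect on cycles, so the mere existence of preimages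
    suffices. *)
Lemma homology_equivalence (C D : chain_complex)
    (f : forall k, {additive C k -> D k}) (g : forall k, {additive D k -> C k}) :
  (forall k x, f k (bd C k x) = bd D k (f k.+1 x)) ->
  (forall k x, g k (bd D k x) = bd C k (g k.+1 x)) ->
  (forall k z, bd_out C k z = 0 -> exists y, bd C k y = z - g k (f k z)) ->
  (forall k z, bd_out D k z = 0 -> exists y, bd D k y = z - f k (g k z)) ->
  forall k, isomorphic (homology C k) (homology D k).
Proof.
move=> fd gd gf fg k.
have fo := bd_out_comm fd; have go := bd_out_comm gd.
have fcyc (z : cycles C k) : in_kernel (bd_out D k) (f k (val z)).
  by apply/eqP; rewrite -fo kernelP raddf0.
pose fz (z : cycles C k) : cycles D k := Kernel (fcyc z).
have fzB : zmod_morphism fz by move=> x y; apply: val_inj; rewrite /= raddfB.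
pose fza : {additive cycles C k -> cycles D k} :=
  HB.pack fz (GRing.isZmodMorphism.Build _ _ fz fzB).
pose p : {additive cycles D k -> homology D k} := quot_pi (boundaries D k).
apply: (@homology_isomorphic _ _ _ (p \o fza)) => [q|z].
  have [w <-] := quot_pi_surj q.
  have gw : in_kernel (bd_out C k) (g k (val w)).
    by apply/eqP; rewrite -go kernelP raddf0.
  exists (Kernel gw); have [y yw] := fg k (val w) (kernelP w).
  by apply/esym/quot_pi_eq/asboolP; exists y; rewrite yw.
apply: iff_trans (homology_class0 _) _; split=> [[y /= yz]|[y yz]].
  have [y' y'z] := gf k (val z) (kernelP z).
  by exists (y' + g k.+1 y); rewrite raddfD y'z -gd yz subrK.
by exists (f k.+1 y); rewrite /= -fd yz.
Qed.

(** [S] is the invariant that makes the next choice possible. Chain maps and homotopies are built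
    with it degree by degree. *)
Lemma dependent_choice (T : nat -> Type) (S : forall k, T k -> Prop)
    (R : forall k, T k -> T k.+1 -> Prop) :
  (exists t, S 0 t) ->
  (forall k t, S k t -> exists t', R k t t' /\ S k.+1 t') ->
  exists t : forall k, T k, S 0 (t 0) /\ forall k, R k (t k) (t k.+1).
Proof.
move=> /cid[t0 St0] next.
pose step k (t : {t | S k t}) : {t | S k.+1 t} :=
  let e := cid (next k (sval t) (svalP t)) in
  exist _ (sval e) (proj2 (svalP e)).
pose fix t k : {t | S k t} :=
  if k is k'.+1 then step k' (t k') else exist _ t0 St0.
exists (fun k => sval (t k)); split=> // k.
exact: (proj1 (svalP (cid (next k (sval (t k)) (svalP (t k)))))).
Qed.

Section NaturalOperations.
Variable A : category.

Program Definition nat_comp (F G H : functor A) (u : natural G H) (t : natural F G) :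
  natural F H := @Natural A F H (fun a => u a \o t a) _.
Next Obligation. by rewrite !nat_comm. Qed.

Program Definition nat_id (F : functor A) : natural F F :=
  @Natural A F F (fun a => idfun) _.

Program Definition nat_sub (F G : functor A) (t u : natural F G) : natural F G :=
  @Natural A F G (fun a => GRing.add_fun (t a) (GRing.opp_fun (u a))) _.
Next Obligation. by rewrite /GRing.add_fun /GRing.opp_fun /= !nat_comm raddfB. Qed.

Lemma nat_subE (F G : functor A) (t u : natural F G) a x :
  nat_sub t u a x = t a x - u a x.
Proof. by []. Qed.

Section KernelLift.
Variables (F G H : functor A) (q : natural G H) (t : natural F G).
Hypothesis qt0 : forall a x, q a (t a x) = 0.

Lemma ker_lift_subproof a x : in_kernel (q a) (t a x).
Proof. exact/eqP/qt0. Qed.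

Definition ker_lift_comp a (x : F a) : kernel (q a) := Kernel (ker_lift_subproof x).

Lemma ker_lift_is_additive a : zmod_morphism (@ker_lift_comp a).
Proof. by move=> x y; apply: val_inj; rewrite /= raddfB. Qed.

HB.instance Definition _ a :=
  GRing.isZmodMorphism.Build _ _ (@ker_lift_comp a) (@ker_lift_is_additive a).

Program Definition ker_lift : natural F (ker_functor q) :=
  @Natural A F (ker_functor q) (fun a => @ker_lift_comp a) _.
Next Obligation. by apply: val_inj; rewrite /= nat_comm. Qed.
End KernelLift.

(** Exactness makes [p] an epimorphism onto the kernel functor of [q]; [t] factors through that
    kernel and is lifted there. *)
Lemma projective_lift (P G H K : functor A) (p : natural G H) (q : natural H K)
    (t : natural P H) :
  projective P -> (forall a x, q a x = 0 <-> exists y, p a y = x) ->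
  (forall a x, q a (t a x) = 0) ->
  exists u : natural P G, forall a x, p a (u a x) = t a x.
Proof.
move=> projP ex qt0.
have qp0 a x : q a (p a x) = 0 by apply/ex; exists x.
have pS a : surjective (ker_lift qp0 a).
  move=> y; have /ex[x xy] := kernelP y; exists x; exact: val_inj.
have [u pu] := projP _ _ _ (ker_lift qt0) pS.
by exists u => a x; have := congr1 val (pu a x).
Qed.
End NaturalOperations.

Section ColimMapTheory.
Variable A : category.

Lemma colim_map_comp (F G H : functor A) (u : natural G H) (t : natural F G) x :
  colim_map (nat_comp u t) x = colim_map u (colim_map t x).
Proof.
elim/colim_ind: x => [|a x|x y xE yE]; first by rewrite !raddf0.
  by rewrite !colim_map_in.
by rewrite !raddfB xE yE.
Qed.

Lemma colim_map_sub (F G : functor A) (u t : natural F G) x :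
  colim_map (nat_sub u t) x = colim_map u x - colim_map t x.
Proof.
elim/colim_ind: x => [|a x|x y xE yE]; first by rewrite !raddf0 addr0.
  by rewrite !colim_map_in -raddfB.
rewrite !raddfB xE yE !opprD. by rewrite addrACA.
Qed.

Lemma colim_map_id (F : functor A) x : colim_map (nat_id F) x = x.
Proof.
elim/colim_ind: x => [|a x|x y xE yE]; first by rewrite !raddf0.
  by rewrite !colim_map_in.
by rewrite !raddfB xE yE.
Qed.

Lemma eq_colim_map (F G : functor A) (u t : natural F G) :
  (forall a x, u a x = t a x) -> colim_map u =1 colim_map t.
Proof.
move=> ut; apply: colim_ext => a x; by rewrite !colim_map_in ut.
Qed.
End ColimMapTheory.

Section Comparison.
Variables (A : category) (F : functor A).

Lemma resolution_map (P Q : projective_resolution F) :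
  exists f : forall k, natural (P k) (Q k),
    (forall a x, res_aug Q a (f 0%N a x) = res_aug P a x) /\
    (forall k a x, res_d Q k a (f k.+1 a x) = f k a (res_d P k a x)).
Proof.
(* [S] says that [f] after the differential of [P] lands in the kernel of the next map of [Q], as
   [projective_lift] requires. *)
pose S k (f : natural (P k) (Q k)) := forall a x,
  match k return (natural (P k) (Q k) -> P k.+1 a -> Prop) with
  | 0 => fun f x => res_aug Q a (f a (res_d P 0 a x)) = 0
  | k'.+1 => fun f x => res_d Q k' a (f a (res_d P k'.+1 a x)) = 0
  end f x.
pose S' k (f : natural (P k) (Q k)) := S k f /\
  match k return (natural (P k) (Q k) -> Prop) with
  | 0 => fun f => forall a x, res_aug Q a (f a x) = res_aug P a x
  | k'.+1 => fun _ => True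
  end f.
pose R k (f : natural (P k) (Q k)) (g : natural (P k.+1) (Q k.+1)) :=
  forall a x, res_d Q k a (g a x) = f a (res_d P k a x).
have [||f [[_ f0] fR]] := @dependent_choice _ S' R; last by exists f.
  have [f0 f0E] := @res_proj _ _ P 0 _ _ _ (res_aug P) (@res_aug_surj _ _ Q).
  exists f0; split=> // a x /=; rewrite f0E.
  by apply/res_exact0; exists x.
move=> k f [Sf _].
suff [g Rg] : exists g, R k f g.
  exists g; split=> //; split=> // a x /=; rewrite Rg.
  have -> : res_d P k a (res_d P k.+1 a x) = 0 by apply/res_exact; exists x.
  by rewrite raddf0.
case: k f Sf => [|k] f Sf.
  have [u uE] := projective_lift (t := nat_comp f (res_d P 0))
    (@res_proj _ _ P 1) (@res_exact0 _ _ Q) Sf.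
  by exists u.
have [u uE] := projective_lift (t := nat_comp f (res_d P k.+1))
    (@res_proj _ _ P k.+2) (@res_exact _ _ Q k) Sf.
by exists u.
Qed.

Lemma resolution_homotopy (P Q : projective_resolution F)
    (u : forall k, natural (P k) (Q k)) :
  (forall a x, res_aug Q a (u 0%N a x) = 0) ->
  (forall k a x, res_d Q k a (u k.+1 a x) = u k a (res_d P k a x)) ->
  exists h : forall k, natural (P k) (Q k.+1),
    (forall a x, res_d Q 0%N a (h 0%N a x) = u 0%N a x) /\
    (forall k a x, res_d Q k.+1 a (h k.+1 a x) =
                   u k.+1 a x - h k a (res_d P k a x)).
Proof.
move=> u0 ud.
have dd k a x : res_d P k a (res_d P k.+1 a x) = 0 by apply/res_exact; exists x.
(* In positive degree the homotopy identity is kept on boundaries only: there the term with the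
   preceding homotopy vanishes, so the invariant involves [h] alone. *)
pose S k (h : natural (P k) (Q k.+1)) :=
  match k return (natural (P k) (Q k.+1) -> Prop) with
  | 0 => fun h => forall a x, res_d Q 0 a (h a x) = u 0 a x
  | k'.+1 => fun h => forall a x, res_d Q k'.+1 a (h a (res_d P k'.+1 a x)) =
      u k'.+1 a (res_d P k'.+1 a x)
  end h.
pose R k (h : natural (P k) (Q k.+1)) (g : natural (P k.+1) (Q k.+2)) :=
  forall a x, res_d Q k.+1 a (g a x) = u k.+1 a x - h a (res_d P k a x).
have [||h [h0 hR]] := @dependent_choice _ S R; last by exists h.
  by have [h hE] := projective_lift (@res_proj _ _ P 0) (@res_exact0 _ _ Q) u0; exists h.
move=> k h Sh.
suff [g Rg] : exists g, R k h g.
  by exists g; split=> // a x; rewrite Rg dd raddf0 subr0.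
pose t := nat_sub (u k.+1) (nat_comp h (res_d P k)).
have t0 a x : res_d Q k a (t a x) = 0.
  rewrite nat_subE raddfB ud /=; apply/eqP; rewrite subr_eq0; apply/eqP.
  by case: k h Sh {t} x => [|k] h Sh x; rewrite Sh.
have [g gE] := projective_lift (t := t) (@res_proj _ _ P k.+1) (@res_exact _ _ Q k) t0.
by exists g.
Qed.

(** [id - g f] lifts the zero map, hence is null-homotopic by some [h]. The colimit keeps this
    identity, and on a cycle [z] the term [h d] drops, so [h z] is the preimage. *)
Lemma colim_homotopy (P Q : projective_resolution F)
    (f : forall k, natural (P k) (Q k)) (g : forall k, natural (Q k) (P k)) :
  (forall a x, res_aug Q a (f 0%N a x) = res_aug P a x) ->
  (forall k a x, res_d Q k a (f k.+1 a x) = f k a (res_d P k a x)) ->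
  (forall a x, res_aug P a (g 0%N a x) = res_aug Q a x) ->
  (forall k a x, res_d P k a (g k.+1 a x) = g k a (res_d Q k a x)) ->
  forall k z, bd_out (colim_complex P) k z = 0 -> exists y,
    bd (colim_complex P) k y = z - colim_map (g k) (colim_map (f k) z).
Proof.
move=> f0 fd g0 gd.
pose u k := nat_sub (nat_id (P k)) (nat_comp (g k) (f k)).
have [||h [h0 hd]] := @resolution_homotopy P P u.
- by move=> a x; rewrite nat_subE raddfB /= g0 f0 subrr.
- by move=> k a x; rewrite !nat_subE raddfB /= gd fd.
move=> k z z0; exists (colim_map (h k) z).
rewrite -colim_map_comp -{2}(colim_map_id z) -colim_map_sub -/(u k).
rewrite -[LHS]/(colim_map (res_d P k) (colim_map (h k) z)).
case: k z z0 => [|k] z z0; rewrite -colim_map_comp.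
  exact: eq_colim_map.
have {}z0 : colim_map (res_d P k) z = 0 by [].
rewrite -[RHS]subr0 -(raddf0 (colim_map (h k))) -z0 -[in RHS]colim_map_comp.
rewrite -colim_map_sub.
apply: eq_colim_map => a x; rewrite nat_subE; exact: hd.
Qed.

(** This reduces a statement about an arbitrary resolution to the cube resolution. *)
Theorem derived_colim_unique (P Q : projective_resolution F) s :
  isomorphic (derived_colim P s) (derived_colim Q s).
Proof.
have [f [f0 fd]] := resolution_map P Q.
have [g [g0 gd]] := resolution_map Q P.
pose cf k : {additive colim_complex P k -> colim_complex Q k} := colim_map (f k).
pose cg k : {additive colim_complex Q k -> colim_complex P k} := colim_map (g k).
apply: (@homology_equivalence _ _ cf cg).
- move=> k x.
  rewrite -[LHS]/(colim_map (f k) (colim_map (res_d P k) x))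
    -[RHS]/(colim_map (res_d Q k) (colim_map (f k.+1) x)).
  by rewrite -!colim_map_comp; apply: eq_colim_map => a y; rewrite /= fd.
- move=> k x.
  rewrite -[LHS]/(colim_map (g k) (colim_map (res_d Q k) x))
    -[RHS]/(colim_map (res_d P k) (colim_map (g k.+1) x)).
  by rewrite -!colim_map_comp; apply: eq_colim_map => a y; rewrite /= gd.
- exact: colim_homotopy.
- exact: colim_homotopy.
Qed.
End Comparison.

(** * Trace monoids *)

Section TraceTheory.
Variables (E : finType) (I : rel E).
Hypotheses (I_irr : irreflexive I) (I_sym : symmetric I).
Local Notation M := (trace_monoid I).
Local Notation cls := (trace_class I).
Local Notation "u ~ v" := (trace_eq I u v) (at level 70).

Lemma trace_size u v : u ~ v -> size u = size v.
Proof.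
by elim=> // [u1 u2 v1 v2 _ IHu _ IHv|u1 u2 u3 _ -> _ ->];
  rewrite // !size_cat IHu IHv.
Qed.

Lemma trace_catl u v w : v ~ w -> u ++ v ~ u ++ w.
Proof. by move=> vw; apply: TraceCat => //; apply: TraceRefl. Qed.

Lemma trace_catr u v w : v ~ w -> v ++ u ~ w ++ u.
Proof. by move=> vw; apply: TraceCat => //; apply: TraceRefl. Qed.

(** Left division of a word by [e]: the first [e] is moved to the front across letters commuting
    with it, and dropped. [None] means that it is blocked or absent. *)
Fixpoint pop (e : E) (u : seq E) : option (seq E) :=
  if u is x :: u' then
    if x == e then Some u'
    else if I x e then omap (cons x) (pop e u') else None
  else None.

Lemma pop_cat e u v :
  pop e (u ++ v) = if pop e u is Some u' then Some (u' ++ v)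
    else if all (I^~ e) u then omap (cat u) (pop e v) else None.
Proof.
elim: u => [|x u IH] /=; first by case: (pop e v).
have [//|xe] := eqVneq x e; case: ifP => //= _; rewrite IH.
by case: (pop e u) => //=; case: ifP => //; case: (pop e v).
Qed.

Lemma all_trace (p : pred E) u v : u ~ v -> all p u = all p v.
Proof.
by elim=> [a b _|u1 u2 v1 v2 _ IHu _ IHv||u1 u2 _ ->|u1 u2 u3 _ -> _ ->];
  rewrite // ?all_cat ?IHu ?IHv //= !andbT andbC.
Qed.

Definition opt_trace (o o' : option (seq E)) : Prop :=
  match o, o' with
  | Some u, Some v => u ~ v
  | None, None => True
  | _, _ => False
  end.

(** Invariance under the relations makes left division well defined on the monoid. In a swap,
    irreflexivity excludes that both letters be [e]; if just one is, the other commutes with it. *)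
Lemma pop_trace e u v : u ~ v -> opt_trace (pop e u) (pop e v).
Proof.
elim=> {u v} [a b ab|u u' v v' uu IHu vv IHv|u|u v _|u v w _ + _].
- have ba : I b a by rewrite I_sym.
  rewrite /=; have [ae|ane] := eqVneq a e; have [be|bne] := eqVneq b e.
  + by move: ab; rewrite ae be I_irr.
  + by rewrite -ae ba /=; apply: TraceRefl.
  + by rewrite -be ab /=; apply: TraceRefl.
  + by case: (I a e); case: (I b e).
- rewrite !pop_cat; move: IHu.
  case: (pop e u) => [w|]; case: (pop e u') => [w'|] //= ww.
    exact: TraceCat.
  rewrite (all_trace _ uu); case: ifP => // _; move: IHv.
  by case: (pop e v) => [x|]; case: (pop e v') => [x'|] //= xx; apply: TraceCat.
- by case: (pop e u) => //= w; apply: TraceRefl.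
- case: (pop e u) (pop e v) => [x|] [y|] //=; exact: TraceSym.
- by case: (pop e u) (pop e v) (pop e w) => [x|] [y|] [z|] //=; apply: TraceTrans.
Qed.

Lemma pop_sound e u v : pop e u = Some v -> u ~ e :: v.
Proof.
elim: u v => [//|x u IH] v /=; have [->|xe] := eqVneq x e.
  by move=> [->]; apply: TraceRefl.
case: ifP => // xIe; case: (pop e u) IH => //= w /(_ w erefl) uw [<-].
apply: TraceTrans (trace_catl [:: x] uw) _.
exact: (@trace_catr w [:: x; e] [:: e; x] (TraceComm xIe)).
Qed.

Lemma cls_repr (m : M) : cls (repr m) = m.
Proof. exact: reprK. Qed.

Lemma clsM u v : (cls u * cls v)%g = cls (u ++ v).
Proof. exact: trace_classM. Qed.

Lemma cls_nil : cls [::] = 1%g.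
Proof. by []. Qed.

Lemma cls_cons e u : cls (e :: u) = (tgen I e * cls u)%g.
Proof. by rewrite clsM. Qed.

Definition tlen (m : M) : nat := size (repr m).

Lemma tlen_cls u : tlen (cls u) = size u.
Proof. exact/trace_size/trace_repr. Qed.

Lemma tlen_gen e m : tlen (tgen I e * m)%g = (tlen m).+1.
Proof. by rewrite -(cls_repr m) -cls_cons !tlen_cls. Qed.

(** The default [[::]] is the value when [e] does not divide [m] on the left; where it does, [tdivK]
    gives the quotient. *)
Definition tdiv (e : E) (m : M) : M := cls (odflt [::] (pop e (repr m))).

Lemma tdivK e m : tdiv e (tgen I e * m)%g = m.
Proof.
rewrite /tdiv -{1}(cls_repr m) -cls_cons.
have := pop_trace e (trace_repr I (e :: repr m)).
rewrite /= eqxx; case: pop => //= u um.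
by rewrite -[RHS]cls_repr; apply/trace_classP.
Qed.

Lemma tgenC e e' : I e e' -> (tgen I e * tgen I e' = tgen I e' * tgen I e)%g.
Proof. by move=> ee; rewrite !clsM; apply/trace_classP/TraceComm. Qed.

(** * Products of commuting sets of generators *)

Section Cliques.
Implicit Types A B : {set E}.

(** The element [[A]]. For a commuting [A] every order of the letters gives it, by [cprod_perm]. *)
Definition cprod A : M := cls (enum A).

Lemma commutingP A a b : commuting I A -> a \in A -> b \in A -> a != b -> I a b.
Proof. by move=> /forall_inP cA /cA /forall_inP + + => /[apply] /implyP. Qed.

Lemma commuting_sub A B : B \subset A -> commuting I A -> commuting I B.
Proof.
move=> /subsetP BA cA; apply/forall_inP => a /BA aA; apply/forall_inP => b /BA bA.
by apply/implyP => ab; apply: commutingP cA aA bA ab.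
Qed.

Lemma commutingU1 A e : (forall a, a \in A -> I a e) -> commuting I A ->
  commuting I (e |: A).
Proof.
move=> Ae cA; apply/forall_inP => a /setU1P[->|aA]; apply/forall_inP => b /setU1P[->|bA];
  apply/implyP => ab.
- by rewrite eqxx in ab.
- by rewrite I_sym Ae.
- by rewrite Ae.
- exact: commutingP cA aA bA ab.
Qed.

Lemma trace_rcons u a : all (I^~ a) u -> rcons u a ~ a :: u.
Proof.
elim: u => [_|x u IH /= /andP[xa /IH ua]]; first exact: TraceRefl.
apply: TraceTrans (trace_catl [:: x] ua) _.
exact: (@trace_catr u [:: x; a] [:: a; x] (TraceComm xa)).
Qed.

Lemma trace_perm u v : {in u &, forall a b, a != b -> I a b} -> uniq u ->
  perm_eq u v -> u ~ v.
Proof.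
elim: u v => [|a u IH] v uI /= => [_|/andP[au uu] uv].
  by rewrite perm_sym => /perm_nilP ->; apply: TraceRefl.
have av : a \in v by rewrite -(perm_mem uv) mem_head.
(* The head of [u] occurs in [v] behind letters [v1] that all commute with it, so it can be brought
   to the front. *)
case/splitPr: av uv => v1 v2 uv.
have uv12 : perm_eq u (v1 ++ v2).
  by rewrite -(perm_cons a); apply: perm_trans uv _; rewrite perm_catC /= perm_cons perm_catC.
have sub x : x \in v1 ++ v2 -> x \in u by rewrite (perm_mem uv12).
apply: TraceTrans (trace_catl [:: a] (IH _ _ uu uv12)) _.
  by move=> x y xu yu; apply: uI; rewrite inE ?xu ?yu orbT.
rewrite -cat_rcons /= -cat_cons; apply/trace_catr/TraceSym/trace_rcons.
apply/allP => x xv1 /=; have xu : x \in u by apply: sub; rewrite mem_cat xv1.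
apply: uI; rewrite ?mem_head ?inE ?xu ?orbT //.
by apply: contraNneq au => <-.
Qed.

Lemma cprod_perm A u : commuting I A -> perm_eq (enum A) u -> cprod A = cls u.
Proof.
move=> cA Au; apply/trace_classP; apply: trace_perm Au; last exact: enum_uniq.
by move=> a b; rewrite !mem_enum => aA bA; apply: commutingP cA aA bA.
Qed.

Lemma cprod0 : cprod set0 = 1%g.
Proof. by rewrite /cprod enum_set0. Qed.

Lemma perm_enumD1 A a : a \in A -> perm_eq (enum A) (a :: enum (A :\ a)).
Proof.
move=> aA; apply: uniq_perm; rewrite ?enum_uniq //= ?enum_uniq ?andbT.
  by rewrite mem_enum !inE eqxx.
move=> x; rewrite inE !mem_enum !inE; case: eqVneq => [->|] //=.
Qed.

Lemma cprodD1 A a : commuting I A -> a \in A ->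
  cprod A = (tgen I a * cprod (A :\ a))%g.
Proof. by move=> cA /perm_enumD1 /(cprod_perm cA) ->; apply: cls_cons. Qed.

Lemma cprodD1r A a : commuting I A -> a \in A ->
  cprod A = (cprod (A :\ a) * tgen I a)%g.
Proof.
move=> cA /perm_enumD1 Aa; rewrite clsM; apply: (cprod_perm cA).
by apply: perm_trans Aa _; rewrite cats1 -perm_rcons perm_refl.
Qed.

(** [pop e] finds no [e] among the letters of [A], so a leading [e] of the product has to come out
    of [m] across all of [A]. Hence a commuting [A] can be enlarged by [e], the move made by the
    contraction. *)
Lemma head_clique A m e w :
  (cprod A * m = tgen I e * w)%g -> e \notin A ->
  (forall a, a \in A -> I a e) /\ exists m', m = (tgen I e * m')%g.
Proof.
rewrite -(cls_repr m) -(cls_repr w) -cls_cons clsM => /trace_classP/(pop_trace e) /=.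
rewrite eqxx => + eA; rewrite pop_cat.
have -> : pop e (enum A) = None.
  case pA : pop => [u|//]; have := all_trace [pred x | x != e] (pop_sound pA).
  rewrite /= eqxx /= => /negbT/allPn[x]; rewrite mem_enum /= negbK => xA /eqP xe.
  by rewrite -xe xA in eA.
case: ifP => // /allP Ae; case pm: (pop e (repr m)) => [u|//] _; split.
  by move=> a aA; apply: Ae; rewrite mem_enum.
by exists (cls u); rewrite -cls_cons; apply/trace_classP/pop_sound.
Qed.
End Cliques.
End TraceTheory.

(** * The cube complex *)

Section Signs.
Variable E : finType.
Implicit Type A : {set E}.

Definition psign A (v : E) : int := (-1) ^+ position A v.

Lemma psign_sqr A v : psign A v * psign A v = 1.
Proof. by rewrite /psign -expr2 sqrr_sign. Qed.

(** Of [v] and [w], the one of lower rank counts in the position of the other, so exactly one of the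
    two positions changes when the other element is removed first. *)
Lemma psign_swap A v w : v \in A -> w \in A -> v != w ->
  psign A v * psign (A :\ v) w = - (psign A w * psign (A :\ w) v).
Proof.
move=> vA wA vw; rewrite /psign (position_remove v wA) (position_remove w vA) !exprD.
have /negPf rvw : enum_rank v != enum_rank w :> nat.
  by apply: contra vw => /eqP/val_inj/enum_rank_inj/eqP.
by case: ltngtP rvw => //= _ _; rewrite expr1 expr0;
  rewrite !(mul1r, mulN1r, mulrN, mulNr, opprK) mulrC.
Qed.

Lemma setU1D1 A v e : v != e -> (e |: A) :\ v = e |: (A :\ v).
Proof.
move=> ve; apply/setP => x; rewrite !inE.
by case: (eqVneq x e) ve => [->|//]; rewrite eq_sym => ->.
Qed.

(** This is [psign_swap] for [e |: A], rearranged by [psign_sqr]: adding [e] and deleting [v]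
    anticommute. *)
Lemma psignU1 A e v : e \notin A -> v \in A ->
  psign (e |: A) v * psign (e |: A) e = - (psign A v * psign (e |: (A :\ v)) e).
Proof.
move=> eA vA; have ve : v != e by apply: contraNneq eA => <-.
have := @psign_swap (e |: A) v e; rewrite !inE eqxx vA orbT => /(_ isT isT ve).
rewrite setU1K // setU1D1 //.
set B := e |: A; set C := e |: (A :\ v) => pq.
have -> : psign B v * psign B e = (psign B v * psign C e) * (psign B e * psign C e).
  by rewrite mulrACA psign_sqr mulr1.
by rewrite pq mulNr mulrACA psign_sqr mul1r.
Qed.

(** As [W] may have 2-torsion, it would not suffice that the sum is its own opposite: pairs are
    split by rank and cancelled against their transposes, and the diagonal is assumed to vanish. *)
Lemma antisymmetric_sum (W : zmodType) (F : E -> E -> W) :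
  (forall v, F v v = 0) -> (forall v w, F v w = - F w v) ->
  \sum_v \sum_w F v w = 0.
Proof.
move=> F0 FN; pose lt (v w : E) := (enum_rank v < enum_rank w)%N.
have -> : \sum_v \sum_w F v w =
    \sum_v \sum_w (if lt v w then F v w else 0) +
    \sum_v \sum_w (if lt w v then F v w else 0).
  rewrite -big_split; apply: eq_bigr => v _; rewrite -big_split; apply: eq_bigr => w _.
  rewrite /lt /=; case: ltngtP => [||/val_inj/enum_rank_inj ->]; rewrite ?addr0 ?add0r //.
rewrite [X in _ + X]exchange_big -big_split big1 // => v _.
rewrite -big_split big1 // => w _ /=.
by case: ifP => _; rewrite ?addr0 // [F w v]FN subrr.
Qed.

Lemma alternating_sum (W : zmodType) A (F : E -> E -> W) :
  (forall v w, v \in A -> w \in A -> v != w -> F v w = F w v) ->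
  \sum_(v in A) \sum_(w in A :\ v) F v w *~ (psign A v * psign (A :\ v) w) = 0.
Proof.
move=> Fsym; rewrite big_mkcond /=.
pose G v w := if [&& v \in A, w \in A & v != w] then
  F v w *~ (psign A v * psign (A :\ v) w) else 0.
rewrite -[RHS](@antisymmetric_sum _ G); last 2 first.
- by move=> v; rewrite /G eqxx !andbF.
- move=> v w; rewrite /G eq_sym andbCA; case: and3P => [[wA vA wv]|_]; last by rewrite oppr0.
  by rewrite -mulrNz -psign_swap ?[v == w]eq_sym ?(Fsym v w) // eq_sym.
apply: eq_bigr => v _; rewrite /G; case: ifP => vA; last by rewrite big1.
by rewrite big_mkcond; apply: eq_bigr => w _; rewrite !inE eq_sym andbC.
Qed.
End Signs.

Section CubeComplex.
Variables (E : finType) (I : rel E).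
Hypotheses (I_irr : irreflexive I) (I_sym : symmetric I).
Variables (X : finType) (pt : X) (a : pointed_action (trace_monoid I) pt).
Local Notation M := (trace_monoid I).
Local Notation tgen := (tgen I).
Local Notation cprod := (cprod I).
Implicit Types (A : {set E}) (m : M).

Definition cell : Type := (X * {set E} * M)%type.
Definition cells : zmodType := freeab cell.
Definition cgen (y : X) A m : cells := fgen (y, A, m).

(** The boundary is split in two because the contraction treats the halves differently: for
    commuting [A], [dupp] keeps the total [[A]m] and [dlow] shortens it by one letter. *)
Definition dlow : {additive cells -> cells} := free_lift (fun c : cell =>
  \sum_(v in c.1.2) cgen (a c.1.1 (tgen v)) (c.1.2 :\ v) c.2 *~ psign c.1.2 v).
Definition dupp : {additive cells -> cells} := free_lift (fun c : cell =>
  \sum_(v in c.1.2) cgen c.1.1 (c.1.2 :\ v) (tgen v * c.2)%g *~ psign c.1.2 v).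
Definition cube_d : {additive cells -> cells} :=
  free_lift (fun c : cell => dlow (fgen c) - dupp (fgen c)).

Lemma dlowE y A m : dlow (cgen y A m) =
  \sum_(v in A) cgen (a y (tgen v)) (A :\ v) m *~ psign A v.
Proof. exact: free_lift_gen. Qed.

Lemma duppE y A m : dupp (cgen y A m) =
  \sum_(v in A) cgen y (A :\ v) (tgen v * m)%g *~ psign A v.
Proof. exact: free_lift_gen. Qed.

Lemma cube_dE z : cube_d z = dlow z - dupp z.
Proof.
elim/freeab_ind: z => [|c|x y xE yE]; first by rewrite !raddf0 addr0.
  exact: free_lift_gen.
by rewrite !raddfB xE yE !opprD addrACA.
Qed.

Lemma cube_d_gen y A m : cube_d (cgen y A m) =
  \sum_(v in A) (cgen (a y (tgen v)) (A :\ v) m - cgen y (A :\ v) (tgen v * m)%g)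
     *~ psign A v.
Proof.
rewrite cube_dE dlowE duppE -sumrB; apply: eq_bigr => v _.
by rewrite mulrzBl.
Qed.

(** The four double faces at [v], [w] add up to an expression symmetric in them, as the two letters
    commute, whereas the sign is antisymmetric. *)
Lemma cube_dd y A m : commuting I A -> cube_d (cube_d (cgen y A m)) = 0.
Proof.
move=> cA; rewrite cube_d_gen raddf_sum /=.
pose F v w := (cgen (a (a y (tgen v)) (tgen w)) (A :\ v :\ w) m
    - cgen (a y (tgen v)) (A :\ v :\ w) (tgen w * m)%g)
  - (cgen (a y (tgen w)) (A :\ v :\ w) (tgen v * m)%g
    - cgen y (A :\ v :\ w) (tgen w * (tgen v * m))%g).
rewrite -[RHS](@alternating_sum _ _ A F).
  apply: eq_bigr => v vA; rewrite raddfMz raddfB !cube_d_gen -sumrB mulrz_suml.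
  by apply: eq_bigr => w _; rewrite -mulrzBl -mulrzA mulrC.
move=> v w vA wA vw; rewrite /F !opprB !setDDl [[set w] :|: _]setUC.
have vIw : I v w by apply: commutingP cA vA wA vw.
by rewrite -!actM !mulgA (tgenC vIw) addrACA [RHS]addrACA; congr (_ + _); rewrite addrC.
Qed.

(** In degree [0] this is the augmentation followed by its section [x -> (x, set0, 1)], the
    projector that the homotopy formula must subtract. *)
Definition base_cell : {additive cells -> cells} := free_lift (fun c : cell =>
  if c.1.2 == set0 then cgen (a c.1.1 c.2) set0 1%g else 0).

Lemma base_cellE y A m : base_cell (cgen y A m) =
  if A == set0 then cgen (a y m) set0 1%g else 0.
Proof. exact: free_lift_gen. Qed.

Lemma base_cell_d z : base_cell (cube_d z) = 0.
Proof.
elim/freeab_ind: z => [|[[y A] m]|x y xE yE]; rewrite ?raddf0 //; last first.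
  by rewrite !raddfB xE yE subrr.
rewrite -[fgen _]/(cgen y A m) cube_d_gen raddf_sum big1 // => v vA /=.
rewrite raddfMz raddfB !base_cellE actM; by case: ifP => _; rewrite ?subrr ?subr0 mul0rz.
Qed.

(* The contracting direction at a cell of total [w = [A]m <> 1]: the first letter
   [e] of the chosen word of [w].  If [e] is not already in [A], it can be moved
   from [m] to [A]. *)
Definition cube_h : {additive cells -> cells} := free_lift (fun c : cell =>
  if repr (cprod c.1.2 * c.2)%g is e :: _ then
    if e \in c.1.2 then 0
    else - (cgen c.1.1 (e |: c.1.2) (tdiv e c.2) *~ psign (e |: c.1.2) e)
  else 0).

Lemma cube_hE y A m : cube_h (cgen y A m) =
  if repr (cprod A * m)%g is e :: _ then
    if e \in A then 0
    else - (cgen y (e |: A) (tdiv e m) *~ psign (e |: A) e)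
  else 0.
Proof. exact: free_lift_gen. Qed.

Lemma repr_cons w e u : repr w = e :: u -> w = (tgen e * trace_class I u)%g.
Proof. by move=> wE; rewrite -cls_cons -wE cls_repr. Qed.

Lemma repr_nil w : repr w = [::] -> w = 1%g :> M.
Proof. by move=> wE; rewrite -(cls_repr w) wE. Qed.

Lemma cube_h_spec y A m : commuting I A ->
  cube_h (cgen y A m) = 0 \/ exists e m',
   [/\ e \notin A, commuting I (e |: A),
       (cprod (e |: A) * m' = cprod A * m)%g &
       cube_h (cgen y A m) = - (cgen y (e |: A) m' *~ psign (e |: A) e)].
Proof.
move=> cA; rewrite cube_hE; case Ew: repr => [|e u]; first by left.
case: ifPn => eA; [by left | right]; exists e, (tdiv e m).
have [Ae [m' mE]] := head_clique I_irr I_sym (repr_cons Ew) eA.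
have cB : commuting I (e |: A) by apply: commutingU1.
rewrite mE tdivK // (@cprodD1r _ _ (e |: A) e) ?setU11 // setU1K //.
by rewrite mulgA.
Qed.

Lemma cprodD1_mul A m v : commuting I A -> v \in A ->
  (cprod (A :\ v) * (tgen v * m) = cprod A * m)%g.
Proof. by move=> cA vA; rewrite (cprodD1r cA vA) mulgA. Qed.

Lemma commutingD1 A v : commuting I A -> commuting I (A :\ v).
Proof. exact/commuting_sub/subD1set. Qed.

(** The letter [e] depends only on the total [[A]m], which [dupp] and [cube_h] preserve; so adding
    and deleting it contracts [dupp] at every cell of nontrivial total. *)
Lemma cube_h_dupp y A m : commuting I A -> (cprod A * m)%g <> 1%g ->
  cgen y A m + dupp (cube_h (cgen y A m)) + cube_h (dupp (cgen y A m)) = 0.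
Proof.
move=> cA; case Ew: (repr (cprod A * m)%g) => [|e u] w1.
  by case: w1; apply: repr_nil.
have hE v : v \in A -> cube_h (cgen y (A :\ v) (tgen v * m)%g) =
    if e \in A :\ v then 0
    else - (cgen y (e |: (A :\ v)) (tdiv e (tgen v * m)%g) *~ psign (e |: (A :\ v)) e).
  by move=> vA; rewrite cube_hE cprodD1_mul // Ew.
rewrite cube_hE Ew duppE raddf_sum /=.
under [X in _ + _ + X]eq_bigr => v vA do rewrite raddfMz /= hE //.
(* If [e] is in [A], only the face deleting [e] survives [cube_h], which puts it back. *)
case: ifPn => eA.
  rewrite raddf0 addr0 (bigD1 e) //= setD11 big1 => [|v /andP[vA ve]]; last first.
    by rewrite in_setD1 eq_sym ve eA mul0rz.
  by rewrite addr0 setD1K // tdivK // mulNrz -mulrzA psign_sqr mulr1z subrr.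
(* Otherwise, deleting [e] from the enlarged cell returns the cell itself, and the other faces
   cancel by [psignU1]. *)
have [Ae [m' mE]] := head_clique I_irr I_sym (repr_cons Ew) eA.
have cB : commuting I (e |: A) by apply: commutingU1.
rewrite mE tdivK // raddfN raddfMz /= duppE big_setU1 //= setU1K //.
rewrite mulrzDl -mulrzA psign_sqr mulr1z opprD addNKr mulrz_suml.
apply/eqP; rewrite addrC subr_eq0; apply/eqP/eq_bigr => v vA.
have ve : v != e by apply: contraNneq eA => <-.
rewrite in_setD1 (negPf eA) andbF mulgA (tgenC (Ae v vA)) -mulgA tdivK //.
rewrite setU1D1 //.
by rewrite mulNrz -!mulrzA psignU1 // mulrNz [psign _ e * _]mulrC.
Qed.

(** The error of the homotopy formula. Its local nilpotency on cells with commuting [A] replaces an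
    exact contraction. *)
Definition cube_N : {additive cells -> cells} := free_lift (fun c : cell =>
  fgen c - cube_d (cube_h (fgen c)) - cube_h (cube_d (fgen c)) - base_cell (fgen c)).

Lemma cube_NE z : cube_N z = z - cube_d (cube_h z) - cube_h (cube_d z) - base_cell z.
Proof.
elim/freeab_ind: z => [|c|x y xE yE]; first by rewrite !raddf0 !addr0.
  exact: free_lift_gen.
have addE (p q p1 q1 p2 q2 p3 q3 : cells) :
    (p - p1 - p2 - p3) - (q - q1 - q2 - q3) =
    (p - q) - (p1 - q1) - (p2 - q2) - (p3 - q3).
  rewrite !opprD !opprK addrACA; congr (_ + _).
  by rewrite addrACA; congr (_ + _); rewrite addrACA.
by rewrite raddfB xE yE addE -!raddfB.
Qed.

Definition cube_nil z := exists k, iter k cube_N z = 0.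

Lemma iter_raddfB (W : zmodType) (f : {additive W -> W}) k x y :
  iter k f (x - y) = iter k f x - iter k f y.
Proof. by elim: k => //= k ->; rewrite raddfB. Qed.

Lemma iter_raddf0 (W : zmodType) (f : {additive W -> W}) k : iter k f 0 = 0.
Proof. by elim: k => //= k ->; rewrite raddf0. Qed.

Lemma cube_nil0 : cube_nil 0. Proof. by exists 0%N. Qed.

Lemma cube_nilB x y : cube_nil x -> cube_nil y -> cube_nil (x - y).
Proof.
move=> [k xk] [l yl]; exists (k + l)%N; rewrite iter_raddfB {1}addnC !iterD xk yl.
by rewrite !iter_raddf0 subr0.
Qed.

Lemma cube_nilN x : cube_nil x -> cube_nil (- x).
Proof. by move=> /(cube_nilB cube_nil0); rewrite sub0r. Qed.

Lemma cube_nilD x y : cube_nil x -> cube_nil y -> cube_nil (x + y).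
Proof. by move=> nx /cube_nilN/(cube_nilB nx); rewrite opprK. Qed.

Lemma cube_nil_sign x A v : cube_nil x -> cube_nil (x *~ psign A v).
Proof.
rewrite /psign -signr_odd => nx; case: odd; first by rewrite expr1 mulrN1z; apply: cube_nilN.
by rewrite expr0 mulr1z.
Qed.

Lemma cube_nil_sum A (F : E -> cells) :
  (forall v, v \in A -> cube_nil (F v)) -> cube_nil (\sum_(v in A) F v).
Proof. move=> nF; elim/big_ind: _ => //; [exact: cube_nil0|exact: cube_nilD]. Qed.

Lemma cube_nil_iter x : cube_nil (cube_N x) -> cube_nil x.
Proof. by move=> [k kx]; exists k.+1; rewrite iterSr. Qed.

Lemma cube_nil_base y : cube_nil (cgen y set0 1%g).
Proof.
exists 1%N; rewrite /= cube_NE base_cellE eqxx act1 cube_hE cprod0 mulg1.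
have -> : repr (1 : M)%g = [::].
  by apply: size0nil; rewrite -/(tlen _) -(cls_nil I) tlen_cls.
by rewrite raddf0 cube_d_gen big_set0 raddf0 !subr0 subrr.
Qed.

(** Induction on the length of the total [[A]m]. By [cube_h_dupp] the cell cancels against the
    [dupp] terms of [cube_N]; what remains goes through [dlow], which drops a letter, or comes from
    a base cell, killed by [cube_N]. *)
Lemma cube_nil_gen y A m : commuting I A -> cube_nil (cgen y A m).
Proof.
move: {2}(tlen _).+1 (ltnSn (tlen (cprod A * m)%g)) => l.
elim: l y A m => // l IH y A m Al cA.
have [w1|/eqP w1] := eqVneq (cprod A * m)%g 1%g.
  (* Lengths add up, so a trivial total forces [A] to be empty, and then [m = 1]. *)
  have A0 : A = set0.
    apply/eqP; apply: contraPT w1 => /set0Pn[v vA] /(congr1 (@tlen _ _)).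
    by rewrite (cprodD1 cA vA) -mulgA tlen_gen -(cls_nil I) tlen_cls.
  by move: w1; rewrite A0 cprod0 mul1g => ->; apply: cube_nil_base.
apply: cube_nil_iter; rewrite cube_NE !cube_dE raddfB.
have addE (x p q r s t : cells) : x + q + s = 0 ->
    x - (p - q) - (r - s) - t = - p - r - t.
  by move=> xqs; rewrite !opprB [x + _]addrA addrACA xqs add0r.
rewrite addE; last exact: cube_h_dupp.
have dlow_nil B k : commuting I B -> (tlen (cprod B * k)%g <= l)%N ->
    cube_nil (dlow (cgen y B k)).
  move=> cB Bl; rewrite dlowE; apply: cube_nil_sum => v vB; apply: cube_nil_sign.
  apply: IH; last exact: commutingD1.
  by move: Bl; rewrite (cprodD1 cB vB) -mulgA tlen_gen.
apply: cube_nilB; last first.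
  by rewrite base_cellE; case: ifP => _; [exact: cube_nil_base|exact: cube_nil0].
apply: cube_nilB.
  apply: cube_nilN; have [->|[e [m' [eA cB mE ->]]]] := cube_h_spec y m cA.
    by rewrite raddf0; apply: cube_nil0.
  rewrite raddfN raddfMz; apply/cube_nilN/cube_nil_sign/dlow_nil => //.
  by rewrite mE.
rewrite dlowE raddf_sum; apply: cube_nil_sum => v vA.
rewrite raddfMz; apply: cube_nil_sign.
have cAv := @commutingD1 _ v cA.
have [->|[e [m' [eA cB mE ->]]]] := cube_h_spec (a y (tgen v)) m cAv.
  exact: cube_nil0.
apply/cube_nilN/cube_nil_sign/IH => //; rewrite mE.
by move: Al; rewrite (cprodD1 cA vA) -mulgA tlen_gen.
Qed.
End CubeComplex.

(** * The cube resolution of the constant functor *)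

Section CubeResolution.
Variables (E : finType) (I : rel E).
Hypotheses (I_irr : irreflexive I) (I_sym : symmetric I).
Variables (X : finType) (pt : X) (a : pointed_action (trace_monoid I) pt).
Local Notation M := (trace_monoid I).
Local Notation tgen := (tgen I).
Local Notation cprod := (cprod I).
Local Notation cell := (cell I X).
Local Notation cells := (cells I X).
Local Notation cube_h := (@cube_h E I X).
Local Notation cgen := (@cgen E I X).
Implicit Types (A : {set E}) (m : M).

Definition cell_at (s : nat) (x : X) : pred cell := fun c =>
  [&& commuting I c.1.2, #|c.1.2| == s & a c.1.1 (cprod c.1.2 * c.2)%g == x].

(** The operators live on the single group [cells]; degree and object only select this direct
    summand, embedded by [cincl] and cut out by [cproj]. Identities are then checked without
    dependent types. *)
Definition cubes (s : nat) (x : X) : zmodType := freeab {c : cell | cell_at s x c}.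

Definition cincl s x : {additive cubes s x -> cells} :=
  free_lift (fun c : {c : cell | cell_at s x c} => fgen (val c)).

Definition cproj s x : {additive cells -> cubes s x} :=
  free_lift (fun c : cell => oapp (@fgen _) 0 (insub c)).

Lemma cincl_gen s x (c : {c : cell | cell_at s x c}) :
  cincl s x (fgen c) = fgen (val c).
Proof. exact: free_lift_gen. Qed.

Lemma cprojK s x z : cproj s x (cincl s x z) = z.
Proof.
elim/freeab_ind: z => [|c|y z yE zE]; first by rewrite !raddf0.
  by rewrite cincl_gen [LHS]free_lift_gen valK.
by rewrite !raddfB yE zE.
Qed.

Lemma cincl_inj s x : injective (cincl s x).
Proof. exact: can_inj (@cprojK s x). Qed.

Definition supported s x (u : cells) : Prop := cincl s x (cproj s x u) = u.

Lemma supported_incl s x z : supported s x (cincl s x z).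
Proof. by rewrite /supported cprojK. Qed.

Lemma supported0 s x : supported s x 0.
Proof. by rewrite /supported !raddf0. Qed.

Lemma supportedB s x u v : supported s x u -> supported s x v -> supported s x (u - v).
Proof. by rewrite /supported !raddfB => -> ->. Qed.

Lemma supportedN s x u : supported s x u -> supported s x (- u).
Proof. by move=> /(supportedB (supported0 s x)); rewrite sub0r. Qed.

Lemma supportedD s x u v : supported s x u -> supported s x v -> supported s x (u + v).
Proof. by rewrite /supported !raddfD => -> ->. Qed.

Lemma supported_sum s x (P : pred E) (F : E -> cells) :
  (forall v, P v -> supported s x (F v)) -> supported s x (\sum_(v | P v) F v).
Proof. by move=> sF; elim/big_ind: _ => //; [apply: supported0|apply: supportedD]. Qed.

Lemma supported_int s x u k : supported s x u -> supported s x (u *~ k).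
Proof. by rewrite /supported !raddfMz => ->. Qed.

Lemma supported_gen s x y A m : cell_at s x (y, A, m) -> supported s x (cgen y A m).
Proof.
move=> c; have <- : cincl s x (fgen (exist (cell_at s x) _ c)) = cgen y A m.
  by rewrite cincl_gen.
exact: supported_incl.
Qed.

Lemma supported_map s x s' x' (f : {additive cells -> cells}) :
  (forall y A m, cell_at s x (y, A, m) -> supported s' x' (f (cgen y A m))) ->
  forall u, supported s x u -> supported s' x' (f u).
Proof.
move=> fS u <-; elim/freeab_ind: (cproj s x u) => [|c|y z yE zE].
- by rewrite !raddf0; apply: supported0.
- rewrite cincl_gen; case: c => [[[y A] m] c] /=; exact: fS.
- by rewrite !raddfB; apply: supportedB.
Qed.

Lemma cell_at_low s x y A m v : v \in A -> cell_at s.+1 x (y, A, m) ->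
  cell_at s x (a y (tgen v), A :\ v, m).
Proof.
move=> vA /and3P[/= cA As /eqP <-]; apply/and3P; split=> /=.
- exact: commutingD1.
- by move: As; rewrite (cardsD1 v) vA.
- by rewrite -actM mulgA -cprodD1.
Qed.

Lemma cell_at_upp s x y A m v : v \in A -> cell_at s.+1 x (y, A, m) ->
  cell_at s x (y, A :\ v, (tgen v * m)%g).
Proof.
move=> vA /and3P[/= cA As /eqP <-]; apply/and3P; split=> /=.
- exact: commutingD1.
- by move: As; rewrite (cardsD1 v) vA.
- by rewrite cprodD1_mul.
Qed.

Lemma supported_d s x u : supported s.+1 x u -> supported s x (cube_d a u).
Proof.
apply: supported_map => y A m c; rewrite cube_d_gen; apply: supported_sum => v vA.
by apply/supported_int/supportedB; apply: supported_gen;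
  [apply: cell_at_low|apply: cell_at_upp].
Qed.

Lemma supported_d0 x u : supported 0 x u -> cube_d a u = 0.
Proof.
move=> <-; elim/freeab_ind: (cproj 0 x u) => [|[[[y A] m] c]|y z yE zE].
- by rewrite !raddf0.
- rewrite cincl_gen [LHS]cube_d_gen; move: c => /and3P[/= _ /eqP/cards0_eq -> _].
  by rewrite big_set0.
- by rewrite !raddfB yE zE subrr.
Qed.

Lemma supported_h s x u : supported s x u -> supported s.+1 x (cube_h u).
Proof.
apply: supported_map => y A m /and3P[/= cA As yx].
have [->|[e [m' [eA cB mE ->]]]] := cube_h_spec I_irr I_sym y m cA.
  exact: supported0.
apply/supportedN/supported_int/supported_gen/and3P; split=> //=.
  by rewrite cardsU1 eA add1n.
by rewrite mE.
Qed.

Definition cubes_aug x : {additive cubes 0 x -> int} := free_lift (fun=> 1 : int).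

Lemma cubes_aug_gen x c : cubes_aug x (fgen c) = 1.
Proof. exact: free_lift_gen. Qed.

Lemma base_cell_incl x z : base_cell a (cincl 0 x z) =
  cgen x set0 1%g *~ cubes_aug x z.
Proof.
elim/freeab_ind: z => [|[[[y A] m] c]|y z yE zE].
- by rewrite !raddf0.
- rewrite cincl_gen cubes_aug_gen mulr1z [LHS]base_cellE.
  move: c => /and3P[/= _ /eqP/cards0_eq -> /eqP <-].
  by rewrite eqxx cprod0 mul1g.
- by rewrite !raddfB yE zE.
Qed.

Lemma base_cell_incl_pos s x z : base_cell a (cincl s.+1 x z) = 0.
Proof.
elim/freeab_ind: z => [|[[[y A] m] c]|y z yE zE].
- by rewrite !raddf0.
- rewrite cincl_gen [LHS]base_cellE; case: eqP => // A0.
  by move: c; rewrite A0 /cell_at /= cards0 andbF.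
- by rewrite !raddfB yE zE subrr.
Qed.

Lemma supported_base s x u : supported s x u -> supported s x (base_cell a u).
Proof.
move=> <-; case: s => [|s]; last by rewrite base_cell_incl_pos; apply: supported0.
rewrite base_cell_incl; apply/supported_int/supported_gen/and3P.
split; rewrite /= ?cards0 // ?cprod0 ?mulg1 ?act1 //.
by apply/forall_inP => v; rewrite inE.
Qed.

Lemma supported_N s x u : supported s x u -> supported s x (cube_N a u).
Proof.
move=> su; rewrite cube_NE; apply: supportedB; last exact: supported_base.
apply: supportedB; first by apply/supportedB => //; apply/supported_d/supported_h.
case: s su => [|s] su; last exact/supported_h/supported_d.
by rewrite (supported_d0 su) raddf0; apply: supported0.
Qed.

Lemma supported_nil s x u : supported s x u -> cube_nil a u.
Proof.
move=> <-; elim/freeab_ind: (cproj s x u) => [|[[[y A] m] c]|y z yE zE].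
- by rewrite raddf0; apply: cube_nil0.
- rewrite cincl_gen; move: c => /and3P[/= cA _ _]; exact: cube_nil_gen.
- by rewrite raddfB; apply: cube_nilB.
Qed.

Lemma supported_dd s x u : supported s x u -> cube_d a (cube_d a u) = 0.
Proof.
move=> <-; elim/freeab_ind: (cproj s x u) => [|[[[y A] m] c]|y z yE zE].
- by rewrite !raddf0.
- rewrite cincl_gen; move: c => /and3P[/= cA _ _]; exact: cube_dd.
- by rewrite !raddfB yE zE subrr.
Qed.

(** Here [cube_N u] is [u] minus the boundary of [cube_h u], and satisfies the same conditions as
    [u]. Iteration reaches [0], and the successive corrections add up to the preimage. *)
Lemma cube_exact s x u : supported s x u -> cube_d a u = 0 -> base_cell a u = 0 ->
  exists2 w, supported s.+1 x w & cube_d a w = u.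
Proof.
move=> su; have [k] := supported_nil su.
elim: k u su => [|k IH] u su.
  by move=> /= -> _ _; exists 0; rewrite ?raddf0 //; apply: supported0.
rewrite iterSr => Nu du bu.
have uE : cube_N a u = u - cube_d a (cube_h u).
  by rewrite cube_NE du bu raddf0 !subr0.
have [||w sw wE] := IH _ (supported_N su) Nu.
- by rewrite uE raddfB du (supported_dd (supported_h su)) subrr.
- by rewrite uE raddfB bu base_cell_d subrr.
exists (w + cube_h u); first by apply: supportedD => //; apply: supported_h.
by rewrite raddfD wE uE subrK.
Qed.

Definition cube_mul m : {additive cells -> cells} :=
  free_lift (fun c : cell => cgen c.1.1 c.1.2 (c.2 * m)%g).

Lemma cube_mul_gen y A m m' : cube_mul m' (cgen y A m) = cgen y A (m * m')%g.
Proof. exact: free_lift_gen. Qed.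

Lemma supported_mul s x x' m u : a x m = x' -> supported s x u ->
  supported s x' (cube_mul m u).
Proof.
move=> xx'; apply: supported_map => y A k /and3P[/= cA As /eqP yx].
rewrite cube_mul_gen; apply/supported_gen/and3P; split=> //=.
by rewrite mulgA actM yx xx'.
Qed.

Lemma cube_mul_d m u : cube_mul m (cube_d a u) = cube_d a (cube_mul m u).
Proof.
elim/freeab_ind: u => [|[[y A] k]|y z yE zE]; first by rewrite !raddf0.
  rewrite -[fgen _]/(cgen y A k) cube_mul_gen !cube_d_gen raddf_sum.
  apply: eq_bigr => v _.
  by rewrite /= raddfMz raddfB !cube_mul_gen mulgA.
by rewrite !raddfB yE zE.
Qed.

Definition cubes_map s x x' (f : act_hom a x x') : {additive cubes s x -> cubes s x'} :=
  cproj s x' \o cube_mul (act_elt f) \o cincl s x.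

Lemma cubes_mapE s x x' (f : act_hom a x x') z :
  cincl s x' (cubes_map s f z) = cube_mul (act_elt f) (cincl s x z).
Proof. exact: supported_mul (act_eltP f) (supported_incl z). Qed.

Lemma cubes_map1 s x z : cubes_map s (act_id a x) z = z.
Proof.
apply: cincl_inj; rewrite cubes_mapE.
elim/freeab_ind: (cincl _ _ _) => [|[[y A] k]|y w yE wE]; first by rewrite !raddf0.
  by rewrite [LHS]cube_mul_gen mulg1.
by rewrite !raddfB yE wE.
Qed.

Lemma cubes_mapM s x y x' (f : act_hom a x y) (g : act_hom a y x') z :
  cubes_map s (act_comp f g) z = cubes_map s g (cubes_map s f z).
Proof.
apply: cincl_inj; rewrite !cubes_mapE.
elim/freeab_ind: (cincl _ _ _) => [|[[v A] k]|v w vE wE]; first by rewrite !raddf0.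
  by rewrite -[fgen _]/(cgen v A k) !cube_mul_gen mulgA.
by rewrite !raddfB vE wE.
Qed.

Definition cube_functor s : functor (act_category a) :=
  @Functor (act_category a) (cubes s) (@cubes_map s) (@cubes_map1 s) (@cubes_mapM s).

Definition cubes_d s x : {additive cubes s.+1 x -> cubes s x} :=
  cproj s x \o cube_d a \o cincl s.+1 x.

Lemma cubes_dE s x z : cincl s x (cubes_d s x z) = cube_d a (cincl s.+1 x z).
Proof. exact/supported_d/supported_incl. Qed.

Lemma cubes_d_nat s x x' (f : act_hom a x x') z :
  cubes_d s x' (cubes_map s.+1 f z) = cubes_map s f (cubes_d s x z).
Proof.
by apply: cincl_inj; rewrite cubes_dE !cubes_mapE cubes_dE cube_mul_d.
Qed.

Definition cube_bd s : natural (cube_functor s.+1) (cube_functor s) :=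
  @Natural _ (cube_functor s.+1) (cube_functor s) (cubes_d s) (@cubes_d_nat s).

(* The basis cell [(y, A, 1)] sits over [y.[A]], and [(y, A, m)] is its image
   under [m : y.[A] -> x]: the functor is a sum of representables. *)
Definition unit_cell s y A : cubes s (a y (cprod A)) := cproj s _ (cgen y A 1%g).

Lemma cell_hom_subproof s x (c : {c : cell | cell_at s x c}) :
  a (a (val c).1.1 (cprod (val c).1.2)) (val c).2 = x.
Proof. by rewrite -actM; case: c => -[[y A] m] /= /and3P[_ _ /eqP]. Qed.

Definition cell_hom s x (c : {c : cell | cell_at s x c}) :
  act_hom a (a (val c).1.1 (cprod (val c).1.2)) x := ActHom (cell_hom_subproof c).

Lemma unit_cell_incl s y A : commuting I A -> #|A| = s ->
  cincl s _ (unit_cell s y A) = cgen y A 1%g.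
Proof.
by move=> cA As; apply/supported_gen/and3P; rewrite /= As mulg1; split.
Qed.

Lemma unit_cell_map s x (c : {c : cell | cell_at s x c}) :
  cubes_map s (cell_hom c) (unit_cell s (val c).1.1 (val c).1.2) = fgen c.
Proof.
apply: cincl_inj; rewrite cubes_mapE cincl_gen.
have /and3P[cA /eqP As _] := valP c.
by rewrite unit_cell_incl // cube_mul_gen mul1g; case: c {cA As} => [[[y A] m] c].
Qed.

Lemma cubes_map_gen s x x' (f : act_hom a x x') (c : {c : cell | cell_at s x c}) :
  exists2 c' : {c : cell | cell_at s x' c},
    cubes_map s f (fgen c) = fgen c' &
    val c' = ((val c).1, ((val c).2 * act_elt f)%g).
Proof.
have c'P : cell_at s x' ((val c).1, ((val c).2 * act_elt f)%g).
  have /and3P[cA As /eqP yx] := valP c.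
  by apply/and3P; split=> //=; rewrite mulgA actM yx (act_eltP f).
exists (exist (cell_at s x') _ c'P) => //.
apply: cincl_inj; rewrite cubes_mapE !cincl_gen.
by case: c c'P => [[[y A] m] c] c'P /=; rewrite [LHS]cube_mul_gen.
Qed.

Lemma cubes_aug_nat x x' (f : act_hom a x x') z :
  cubes_aug x' (cubes_map 0 f z) = cubes_aug x z.
Proof.
elim/freeab_ind: z => [|c|y z yE zE]; first by rewrite !raddf0.
  by have [c' -> _] := cubes_map_gen f c; rewrite !cubes_aug_gen.
by rewrite !raddfB yE zE.
Qed.

Definition cube_aug : natural (cube_functor 0) (const_functor (act_category a) int) :=
  @Natural _ (cube_functor 0) (const_functor (act_category a) int) cubes_aug
    cubes_aug_nat.

(** As in the Yoneda lemma, the values on unit cells are lifted along [p] freely, and the cell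
    [(y, A, m)] receives the image of the lift under [m]. *)
Lemma cube_projective s : projective (cube_functor s).
Proof.
move=> G H p t p_surj.
have lift_ex (u : X * {set E}) :
  exists y : G (a u.1 (cprod u.2)), p _ y = t _ (unit_cell s u.1 u.2) by exact: p_surj.
pose l u := sval (cid (lift_ex u)).
have lE u : p _ (l u) = t _ (unit_cell s u.1 u.2) by rewrite /l; case: cid.
pose v x : {additive cube_functor s x -> G x} :=
  free_lift (fun c : {c : cell | cell_at s x c} =>
    @fmap (act_category a) G _ _ (cell_hom c) (l (val c).1)).
have vE x (c : {c : cell | cell_at s x c}) :
    v x (fgen c) = @fmap (act_category a) G _ _ (cell_hom c) (l (val c).1).
  exact: free_lift_gen.
have v_nat x x' (f : @Defs.hom (act_category a) x x') z :
    v x' (fmap (cube_functor s) f z) = fmap G f (v x z).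
  elim/freeab_ind: z => [|c|y z yE zE]; [by rewrite !raddf0| |by rewrite !raddfB yE zE].
  have [c' fc c'E] := cubes_map_gen f c.
  rewrite [fmap _ f _]fc !vE -fmapM.
  have lc : (val c').1 = (val c).1 by rewrite c'E.
  have hc : act_elt (cell_hom c') = act_elt (act_comp (cell_hom c) f).
    by rewrite /= c'E.
  (* The source of [cell_hom c'] depends on [(val c').1], so the arrow is generalised before that is
     rewritten. *)
  move: (cell_hom c') hc; rewrite lc => h hc.
  by congr (fmap G _ _); apply: act_hom_eq.
exists (Natural v_nat) => x z /=.
elim/freeab_ind: z => [|c|y z yE zE]; [by rewrite !raddf0| |by rewrite !raddfB yE zE].
by rewrite vE nat_comm lE -nat_comm [fmap _ _ _]unit_cell_map.
Qed.

Lemma cubes_aug_surj x : surjective (cubes_aug x).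
Proof.
move=> k; have c : cell_at 0 x (x, set0, 1%g).
  apply/and3P; rewrite /= cards0 cprod0 mulg1 act1; split=> //.
  by apply/forall_inP => v; rewrite inE.
exists (fgen (exist (cell_at 0 x) _ c) *~ k).
by rewrite raddfMz cubes_aug_gen intz.
Qed.

Lemma cube_aug_exact x (z : cubes 0 x) :
  cubes_aug x z = 0 <-> exists y, cubes_d 0 x y = z.
Proof.
split=> [z0|[y <-]].
  have [||w sw wE] := cube_exact (supported_incl z).
  - exact/supported_d0/supported_incl.
  - by rewrite base_cell_incl z0 mulr0z.
  by exists (cproj _ _ w); apply: cincl_inj; rewrite cubes_dE sw.
have := base_cell_incl (cubes_d 0 x y); rewrite cubes_dE base_cell_d.
(* [len] sends each cell to [1], so it reads off the augmentation as the coefficient of a base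
   cell. *)
pose len : {additive cells -> int} := free_lift (fun=> 1 : int).
by move/(congr1 len)/esym; rewrite raddf0 raddfMz [len _]free_lift_gen intz.
Qed.

Lemma cube_bd_exact s x (z : cubes s.+1 x) :
  cubes_d s x z = 0 <-> exists y, cubes_d s.+1 x y = z.
Proof.
split=> [z0|[y <-]].
  have [||w sw wE] := cube_exact (supported_incl z).
  - by rewrite -cubes_dE z0 raddf0.
  - exact: base_cell_incl_pos.
  by exists (cproj _ _ w); apply: cincl_inj; rewrite cubes_dE sw.
apply: cincl_inj; rewrite !cubes_dE raddf0.
exact: supported_dd (supported_incl y).
Qed.

Definition cube_resolution : projective_resolution (const_functor (act_category a) int) :=
  @Resolution _ _ cube_functor cube_bd cube_aug cube_projective cubes_aug_surj
    cube_aug_exact cube_bd_exact.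
End CubeResolution.

(** * The colimit of the cube resolution *)

Lemma ffun_mulrz (T : finType) (W : zmodType) (g : {ffun T -> W}) k x :
  (g *~ k) x = g x *~ k.
Proof. by case: k => n; rewrite ?NegzE ?mulrNz -!pmulrn ?ffunE ffunMnE. Qed.

(** * Push-forward along a self-map and the twisted complex *)

Section PushForward.
Variables (X : finType) (f : X -> X).

Section Push.
Variable W : zmodType.

Definition push (c : {ffun X -> W}) : {ffun X -> W} :=
  [ffun x => \sum_(y | f y == x) c y].

Lemma push_is_additive : zmod_morphism push.
Proof.
by move=> c c'; apply/ffunP => x; rewrite !ffunE -sumrB; apply: eq_bigr => y _; rewrite !ffunE.
Qed.

HB.instance Definition _ :=
  GRing.isZmodMorphism.Build {ffun X -> W} {ffun X -> W} push push_is_additive.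

Lemma iter_pushE k (c : {ffun X -> W}) x :
  iter k push c x = \sum_(y | iter k f y == x) c y.
Proof.
elim: k x => [|k IH] x /=; first by rewrite big_pred1_eq.
rewrite ffunE (eq_bigr _ (fun y _ => IH y)).
rewrite [RHS](partition_big (fun y => iter k f y) (fun y => f y == x)) //=.
apply: eq_bigr => y /eqP fy; apply: eq_bigl => z.
by case: eqP => [->|]; rewrite ?andbF // fy eqxx.
Qed.
End Push.

Section Pointwise.
Variables (V W : zmodType) (g : {additive V -> W}).

Definition pointwise (c : {ffun X -> V}) : {ffun X -> W} := [ffun x => g (c x)].

Lemma pointwise_is_additive : zmod_morphism pointwise.
Proof. by move=> c c'; apply/ffunP => x; rewrite !ffunE raddfB. Qed.

HB.instance Definition _ :=
  GRing.isZmodMorphism.Build {ffun X -> V} {ffun X -> W} pointwise pointwise_is_additive.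

Lemma push_pointwise c : push (pointwise c) = pointwise (push c).
Proof.
by apply/ffunP => x; rewrite !ffunE raddf_sum; apply: eq_bigr => y _; rewrite ffunE.
Qed.
End Pointwise.

Section TwistedComplex.
Variable C : chain_complex.

(* The complex [Z[X] (x) C] with differential [(f - 1) (x) bd]. *)
Definition twist_bd k (c : {ffun X -> C k.+1}) : {ffun X -> C k} :=
  push (pointwise (bd C k) c) - pointwise (bd C k) c.

Lemma twist_bdE k (c : {ffun X -> C k.+1}) x :
  twist_bd c x = \sum_(y | f y == x) bd C k (c y) - bd C k (c x).
Proof.
by rewrite !ffunE; congr (_ - _); apply: eq_bigr => y _; rewrite ffunE.
Qed.

Lemma twist_bd_is_additive k : zmod_morphism (@twist_bd k).
Proof. move=> c c1; rewrite /twist_bd !raddfB. by rewrite addrACA. Qed.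

HB.instance Definition _ k :=
  GRing.isZmodMorphism.Build _ _ (@twist_bd k) (@twist_bd_is_additive k).

Lemma twist_bdbd k (c : {ffun X -> C k.+2}) : twist_bd (twist_bd c) = 0.
Proof.
have dd : pointwise (bd C k) (twist_bd c) = 0.
  by apply/ffunP => x; rewrite /twist_bd push_pointwise !ffunE raddfB !bdbd subrr.
by rewrite {1}/twist_bd dd raddf0 subrr.
Qed.

Definition twist_complex : chain_complex :=
  @ChainComplex (fun k => {ffun X -> C k} : zmodType)
    (fun k => @twist_bd k : {additive _ -> _}) twist_bdbd.
End TwistedComplex.
End PushForward.

Section ColimitOfCubes.
Variables (E : finType) (I : rel E).
Hypotheses (I_irr : irreflexive I) (I_sym : symmetric I).
Variables (X : finType) (pt : X) (a : pointed_action (trace_monoid I) pt).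
Variable f : X -> X.
Hypothesis af : forall x e, a x (tgen I e) = f x.
Local Notation K := (commuting_complex I).
Local Notation D := (twist_complex f (aug_complex K)).
Local Notation cells := (cells I X).
Local Notation cincl := (@cincl E I X pt a).
Local Notation Q := (cube_resolution I_irr I_sym a).

Lemma commuting0 : commuting I set0.
Proof. by apply/forall_inP => v; rewrite inE. Qed.

Lemma faceE s (A : {set E}) : face K s A = commuting I A && (#|A| == s).
Proof.
by rewrite /face /= /commuting_simplex; case: eqVneq => [->|] //=; rewrite commuting0.
Qed.

(** The basis element at [x] and [A] of the tensor product, for an arbitrary set [A]: it is [0]
    unless [A] is a face with [s] vertices. *)
Definition dirac s (x : X) (A : {set E}) : {ffun X -> aug_chain K s} :=
  [ffun y => [ffun B : {B | face K s B} => ((y == x) && (val B == A))%:R]].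

(** The terms at [f x] match the lower faces of a cell and those at [x] the upper ones, so the
    cubical boundary becomes the twisted one. *)
Lemma dirac_bd s x A : face K s.+1 A ->
  bd D s (dirac s.+1 x A) =
  \sum_(v in A) (dirac s (f x) (A :\ v) - dirac s x (A :\ v)) *~ psign A v.
Proof.
move=> FA.
have bdE y (B : {B | face K s B}) :
    aug_bd (K := K) (dirac s.+1 x A y) B = (y == x)%:R * incidence A (val B).
  pose A' : {A | face K s.+1 A} := exist _ A FA.
  rewrite ffunE (bigD1 A') //= !ffunE eqxx andbT big1 => [|C CA].
    by rewrite addr0 mulrC.
  by rewrite !ffunE -[A]/(val A') val_eqE (negPf CA) andbF mulr0.
apply/ffunP => y; apply/ffunP => B.
have incE : incidence A (val B) = \sum_(v in A) (val B == A :\ v)%:R * psign A v.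
  rewrite /incidence big_mkcondr; apply: eq_bigr => v _; rewrite eq_sym.
  by case: ifP; rewrite ?mul1r ?mul0r.
transitivity (((y == f x)%:R - (y == x)%:R) * incidence A (val B)).
  rewrite [bd D s _ y]twist_bdE [LHS]ffunE [X in _ + X]ffunE sum_ffunE.
  rewrite (eq_bigr _ (fun z _ => bdE z B)) [X in _ - X]bdE mulrBl.
  congr (_ - _); rewrite -mulr_suml; congr (_ * _).
  rewrite eq_sym; case: eqP => fx; last first.
    by rewrite big1 // => z /eqP fz; case: eqP => // zx; case: fx; rewrite -zx.
  by rewrite (bigD1 x) ?fx ?eqxx //= big1 ?addr0 // => z /andP[_ /negPf ->].
rewrite incE mulr_sumr !sum_ffunE; apply: eq_bigr => v _.
rewrite !ffun_mulrz !ffunE -mulrzr intz mulrA; congr (_ * _).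
by do 3!case: eqP => _.
Qed.

(** Forgetting [m] is compatible with the arrows, which act on [m] only, so this descends to the
    colimit. *)
Definition cells_dirac s : {additive cells -> {ffun X -> aug_chain K s}} :=
  free_lift (fun c => dirac s c.1.1 c.1.2).

Lemma cells_dirac_d s x (z : cubes a s.+1 x) :
  cells_dirac s (cube_d a (cincl _ _ z)) = bd D s (cells_dirac s.+1 (cincl _ _ z)).
Proof.
elim/freeab_ind: z => [|[[[y A] m] c]|y z yE zE]; first by rewrite !raddf0.
  rewrite cincl_gen /= -[fgen _]/(cgen y A m) cube_d_gen.
  rewrite raddf_sum [cells_dirac _ _]free_lift_gen /=.
  move: c => /and3P[/= cA As _].
  rewrite [RHS]dirac_bd; last by rewrite faceE cA.
  apply: eq_bigr => v _; rewrite raddfMz raddfB.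
  by rewrite ![cells_dirac _ _]free_lift_gen /= af.
rewrite raddfB (raddfB (cube_d a)) !(raddfB (cells_dirac _)) yE zE; apply/esym/raddfB.
Qed.

Definition cubes_dirac s x : {additive cubes a s x -> {ffun X -> aug_chain K s}} :=
  cells_dirac s \o cincl s x.

Lemma cubes_dirac_map s x x' (g : act_hom a x x') z :
  cubes_dirac s x' (cubes_map s g z) = cubes_dirac s x z.
Proof.
elim/freeab_ind: z => [|c|y z yE zE]; first by rewrite !raddf0.
  have [c' -> c'E] := cubes_map_gen g c.
  by rewrite /cubes_dirac /= !cincl_gen ![cells_dirac _ _]free_lift_gen c'E.
by rewrite !raddfB yE zE.
Qed.

Definition colim_dirac s : {additive colim (cube_functor a s) -> {ffun X -> aug_chain K s}} :=
  @colim_desc _ (cube_functor a s) _ (cubes_dirac s) (@cubes_dirac_map s).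

Lemma colim_dirac_in s x (z : cubes a s x) :
  colim_dirac s (@colim_in _ (cube_functor a s) x z) = cells_dirac s (cincl _ _ z).
Proof. exact: colim_desc_in. Qed.

Definition unit_class s y (A : {set E}) : colim (cube_functor a s) :=
  @colim_in _ (cube_functor a s) _ (unit_cell a s y A).

Definition dirac_colim s (c : {ffun X -> aug_chain K s}) : colim (cube_functor a s) :=
  \sum_y \sum_(A : {A | face K s A}) unit_class s y (val A) *~ c y A.

Lemma dirac_colim_is_additive s : zmod_morphism (@dirac_colim s).
Proof.
move=> c c'; rewrite /dirac_colim -sumrB; apply: eq_bigr => y _.
by rewrite -sumrB; apply: eq_bigr => A _; rewrite !ffunE mulrzBr.
Qed.

HB.instance Definition _ s :=
  GRing.isZmodMorphism.Build _ _ (@dirac_colim s) (@dirac_colim_is_additive s).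

Lemma unit_class_dirac s y A : face K s A ->
  colim_dirac s (unit_class s y A) = dirac s y A.
Proof.
rewrite faceE => /andP[cA /eqP As].
by rewrite colim_dirac_in unit_cell_incl // [LHS]free_lift_gen.
Qed.

Lemma dirac_colimK s : cancel (@dirac_colim s) (colim_dirac s).
Proof.
move=> c.
have -> : colim_dirac s (dirac_colim c) =
    \sum_y \sum_(A : {A | face K s A}) dirac s y (val A) *~ c y A.
  rewrite raddf_sum; apply: eq_bigr => y _; rewrite raddf_sum; apply: eq_bigr => A _.
  by rewrite raddfMz unit_class_dirac //; apply: valP.
apply/ffunP => x; apply/ffunP => B; rewrite !sum_ffunE (bigD1 x) //= !sum_ffunE.
rewrite (bigD1 B) //= !ffun_mulrz !ffunE !eqxx intz big1 ?addr0 => [|A AB]; last first.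
  by rewrite !ffun_mulrz !ffunE eqxx val_eqE eq_sym (negPf AB) mul0rz.
rewrite big1 ?addr0 // => y yx; rewrite !sum_ffunE big1 // => A _.
by rewrite !ffun_mulrz !ffunE eq_sym (negPf yx) mul0rz.
Qed.

(** A cell [(y, A, m)] is the image of the unit cell at [(y, A)], hence has the same class in the
    colimit. *)
Lemma colim_diracK s : cancel (colim_dirac s) (@dirac_colim s).
Proof.
move=> q; elim/colim_ind: q => [|x z|y z yE zE]; first by rewrite !raddf0.
  rewrite colim_dirac_in.
  elim/freeab_ind: z => [|c|y z yE zE]; first by rewrite !raddf0.
    rewrite cincl_gen [cells_dirac _ _]free_lift_gen -(unit_cell_map c).
    rewrite [RHS](@colim_in_comm _ (cube_functor a s)) -/(unit_class _ _ _).
    have /and3P[cA As _] := valP c.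
    have FA : face K s (val c).1.2 by rewrite faceE cA.
    rewrite /dirac_colim (bigD1 (val c).1.1) //= [X in _ + X]big1 ?addr0 => [|y yc].
      pose A' : {A | face K s A} := exist (face K s) _ FA.
      rewrite (bigD1 A') //= !ffunE !eqxx mulr1z big1 ?addr0 // => A AFA.
      by rewrite !ffunE -[(sval c).1.2]/(val A') val_eqE (negPf AFA).
    by rewrite big1 // => A _; rewrite !ffunE (negPf yc) mulr0z.
  rewrite (raddfB (cincl s x)) (raddfB (cells_dirac s)) (raddfB (@dirac_colim s)).
  rewrite [X in X - _]yE [X in _ - X]zE; exact/esym/raddfB.
by rewrite (raddfB (colim_dirac s)) (raddfB (@dirac_colim s)) [X in X - _]yE [X in _ - X]zE.
Qed.

Lemma colim_dirac_bd s q :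
  colim_dirac s (colim_map (cube_bd a s) q) = bd D s (colim_dirac s.+1 q).
Proof.
elim/colim_ind: q => [|x z|y z yE zE]; first by rewrite !raddf0.
  by rewrite colim_map_in !colim_dirac_in cubes_dE cells_dirac_d.
rewrite (raddfB (colim_map _)) !(raddfB (colim_dirac _)) yE zE; exact/esym/raddfB.
Qed.

Lemma cube_homology s : isomorphic (derived_colim Q s) (homology D s).
Proof.
have bdC k x : bd D k (colim_dirac k.+1 x) = colim_dirac k (bd (colim_complex Q) k x).
  by rewrite -colim_dirac_bd.
apply: (@homology_equivalence (colim_complex Q) D colim_dirac (fun k => @dirac_colim k)).
- by move=> k x; rewrite bdC.
- move=> k x; apply: (can_inj (@colim_diracK k)).
  by rewrite dirac_colimK -bdC dirac_colimK.
- by move=> k z _; exists 0; rewrite raddf0 [X in _ - X]colim_diracK subrr.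
- by move=> k z _; exists 0; rewrite raddf0 [X in _ - X]dirac_colimK subrr.
Qed.
End ColimitOfCubes.

(** * Homology of the twisted complex *)

Lemma isomorphic_ffun_card (T T' : finType) (W : zmodType) : #|T| = #|T'| ->
  isomorphic {ffun T -> W} {ffun T' -> W}.
Proof.
move=> TT'; have [g [h gK hK]] : exists g : T' -> T, bijective g.
  exists (fun y => enum_val (cast_ord (esym TT') (enum_rank y))).
  exists (fun x => enum_val (cast_ord TT' (enum_rank x))) => x.
    by rewrite enum_valK cast_ordKV enum_rankK.
  by rewrite enum_valK cast_ordK enum_rankK.
pose F (c : {ffun T -> W}) : {ffun T' -> W} := [ffun y => c (g y)].
have FB : zmod_morphism F by move=> c c'; apply/ffunP => y; rewrite !ffunE.
pose Fa : {additive {ffun T -> W} -> {ffun T' -> W}} :=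
  HB.pack F (GRing.isZmodMorphism.Build _ _ F FB).
exists Fa; exists (fun c : {ffun T' -> W} => [ffun x => c (h x)]) => c;
  by apply/ffunP => x; rewrite !ffunE ?gK ?hK.
Qed.

Lemma isomorphic_prod (A B A' B' : zmodType) : isomorphic A A' -> isomorphic B B' ->
  isomorphic (A * B)%type (A' * B')%type.
Proof.
move=> [f [f' fK f'K]] [g [g' gK g'K]].
pose F (u : A * B) : A' * B' := (f u.1, g u.2).
have FB : zmod_morphism F by move=> u v; rewrite /F /= !raddfB.
pose Fa : {additive (A * B)%type -> (A' * B')%type} :=
  HB.pack F (GRing.isZmodMorphism.Build _ _ F FB).
by exists Fa; exists (fun u => (f' u.1, g' u.2)) => -[u v]; rewrite /= /F /= ?fK ?gK ?f'K ?g'K.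
Qed.

Section TwistedHomology.
Variables (X : finType) (f : X -> X) (pt : X).
Hypotheses (f_pt : f pt = pt) (f_nil : forall x, exists k, iter k f x = pt).

Lemma iter_root : exists k, forall x, iter k f x = pt.
Proof.
(* The maximum of the individual exponents serves all nodes, as the root is fixed. *)
pose k x := sval (cid (f_nil x)); exists (\max_x k x) => x.
have -> : (\max_x k x = (\max_x k x - k x) + k x)%N.
  by rewrite subnK // (bigmax_sup x).
by rewrite iterD /k; case: cid => j /= ->; elim: (_ - _)%N => //= i ->.
Qed.

(** A fixed [v] equals its image under a power of [push] that moves all mass to the root. *)
Lemma push_fixed (W : zmodType) (v : {ffun X -> W}) :
  push f v = v <-> forall x, x != pt -> v x = 0.
Proof.
split=> [pv x xpt|v0].
  have [k kP] := iter_root.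
  have <- : iter k (push f (W := W)) v = v by elim: k {kP} => //= k ->.
  by rewrite iter_pushE big1 // => y; rewrite kP eq_sym (negPf xpt).
have fy x y : x != pt -> f y == x -> y != pt.
  by move=> xpt /eqP fy; apply: contraNneq xpt => ypt; rewrite -fy ypt f_pt.
apply/ffunP => x; rewrite ffunE; have [->|xpt] := eqVneq x pt.
  by rewrite (bigD1 pt) ?f_pt //= big1 ?addr0 // => y /andP[_ /v0].
by rewrite v0 // big1 // => y /(fy _ _ xpt)/v0.
Qed.

Lemma sum_push (W : zmodType) (v : {ffun X -> W}) : \sum_x push f v x = \sum_x v x.
Proof.
rewrite [RHS](partition_big f predT) //=; apply: eq_bigr => x _; exact: ffunE.
Qed.

Lemma push_sub1_onto (W : zmodType) (v : {ffun X -> W}) :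
  \sum_x v x = 0 -> exists w, push f w - w = v.
Proof.
move=> v0; have [k kP] := iter_root.
(* The geometric series inverting [f - 1] is finite: the [k]-th power of [push] moves the total
   mass, here [0], to the root. *)
exists (- \sum_(i < k) iter i (push f (W := W)) v).
have kv : iter k (push f (W := W)) v = 0.
  apply/ffunP => x; rewrite iter_pushE ffunE; have [->|xpt] := eqVneq x pt.
    by rewrite -[RHS]v0; apply: eq_bigl => y; rewrite kP eqxx.
  by rewrite big1 // => y; rewrite kP eq_sym (negPf xpt).
have tel j : push f (\sum_(i < j) iter i (push f (W := W)) v) -
    \sum_(i < j) iter i (push f (W := W)) v = iter j (push f (W := W)) v - v.
  elim: j => [|j IH]; first by rewrite big_ord0 raddf0 !subrr.
  by rewrite big_ord_recr raddfD opprD addrACA IH /= addrC addrA subrK.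
by rewrite raddfN -opprD tel kv sub0r opprK.
Qed.

Variable C : chain_complex.
Local Notation D := (twist_complex f C).

(** In positive degree, the differential vanishes when the pointwise boundary of [c] is fixed by
    [push], that is, supported at the root. The value at the root is therefore unconstrained. *)
Lemma twist_cycle k (c : {ffun X -> C k}) :
  bd_out D k c = 0 <-> forall x, x != pt -> bd_out C k (c x) = 0.
Proof.
case: k c => [|k] c; first by split.
set v := pointwise (bd C k) c.
apply: (@iff_trans _ (push f v = v)).
  split=> [d0|pv]; last exact: etrans (congr1 (fun w => w - v) pv) (subrr v).
  by apply/eqP; rewrite -subr_eq0; apply/eqP.
by rewrite push_fixed; split=> v0 x /v0; rewrite ffunE.
Qed.

(** The image of [push - 1] consists of the functions of mass zero. For the converse, preimages are
    chosen off the root and completed at the root to have mass zero. *)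
Lemma twist_boundary k (c : {ffun X -> C k}) :
  (exists b, bd D k b = c) <->
  (forall x, x != pt -> exists b, bd C k b = c x) /\ \sum_x c x = 0.
Proof.
split=> [[b <-]|[cb c0]].
  split=> [x _|].
    exists (\sum_(y | f y == x) b y - b x).
    by rewrite raddfB raddf_sum [RHS]twist_bdE.
  set v := pointwise (bd C k) b.
  transitivity (\sum_x push f v x - \sum_x v x); last by rewrite sum_push subrr.
  rewrite -sumrB.
  apply: eq_bigr => x _; rewrite [LHS]twist_bdE !ffunE; congr (_ - _).
  by apply: eq_bigr => y _; rewrite ffunE.
have bP x : exists b, x != pt -> bd C k b = c x.
  have [->|xpt] := eqVneq x pt; first by exists 0.
  by have [b bE] := cb _ xpt; exists b.
pose b0 x := sval (cid (bP x)).
have b0E x : x != pt -> bd C k (b0 x) = c x by rewrite /b0; case: cid.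
pose b : {ffun X -> C k.+1} :=
  [ffun x => if x == pt then - \sum_(y | y != pt) b0 y else b0 x].
(* At the root, the equality follows from the mass of [c] being zero. *)
have bE : pointwise (bd C k) b = c.
  apply/ffunP => x; rewrite !ffunE; case: eqVneq => [->|/b0E //].
  rewrite raddfN raddf_sum (eq_bigr c b0E) //.
  apply/esym/eqP; rewrite -addr_eq0; apply/eqP; rewrite -[RHS]c0.
  by rewrite [RHS](bigD1 pt).
have [|w wb] := @push_sub1_onto _ b.
  rewrite (bigD1 pt) //= ffunE eqxx addrC; apply/eqP; rewrite subr_eq0; apply/eqP.
  by apply: eq_bigr => x /negPf xpt; rewrite ffunE xpt.
by exists w; rewrite -bE -wb [LHS]/(twist_bd _ _) /twist_bd push_pointwise -raddfB.
Qed.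

(** A cycle is sent to the classes of its values off the root and to its total mass; by
    [twist_boundary] both vanish exactly on boundaries. *)
Lemma twist_homology k :
  isomorphic (homology D k)
    ({ffun {x | x != pt} -> homology C k} * C k)%type.
Proof.
have coord_cycle (c : cycles D k) (x : {x | x != pt}) :
    in_kernel (bd_out C k) ((val c : {ffun X -> C k}) (val x)).
  exact/eqP/(proj1 (twist_cycle _) (kernelP c))/(valP x).
pose coord c x : cycles C k := Kernel (coord_cycle c x).
pose p : {additive cycles C k -> homology C k} := quot_pi (boundaries C k).
pose F (c : cycles D k) : {ffun {x | x != pt} -> homology C k} * C k :=
  ([ffun x => p (coord c x)], \sum_x (val c : {ffun X -> C k}) x).
have FB : zmod_morphism F.
  move=> c c'; congr pair.
    apply/ffunP => x; rewrite !ffunE -raddfB; congr (p _); apply: val_inj.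
    by rewrite /= !ffunE.
  by rewrite -sumrB; apply: eq_bigr => x _; rewrite !ffunE.
pose Fa : {additive cycles D k -> ({ffun {x | x != pt} -> homology C k} * C k)%type} :=
  HB.pack F (GRing.isZmodMorphism.Build _ _ F FB).
apply: (@homology_isomorphic _ _ _ Fa) => [[h t]|z].
  have rep x : exists z, p z = h x by apply: quot_pi_surj.
  pose r x := sval (cid (rep x)).
  have rE x : p (r x) = h x by rewrite /r; case: cid.
  pose c0 x : C k := oapp (fun x => val (r x)) 0 (insub x).
  (* The value at the root is free in a cycle, so it adjusts the mass to [t]. *)
  pose c : {ffun X -> C k} :=
    [ffun x => if x == pt then t - \sum_(y | y != pt) c0 y else c0 x].
  have cE (x : {x | x != pt}) : c (val x) = val (r x).
    by rewrite ffunE (negPf (valP x)) /c0 valK.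
  have cz : in_kernel (bd_out D k) c.
    apply/eqP/twist_cycle => x xpt.
    by rewrite (cE (exist (fun x => x != pt) x xpt)) kernelP.
  exists (Kernel cz); congr pair.
    apply/ffunP => x; rewrite ffunE -rE; congr (p _); apply: val_inj; exact: cE.
  rewrite (bigD1 pt) //= [c pt]ffunE eqxx -[RHS](subrK (\sum_(y | y != pt) c0 y)).
  by congr (_ + _); apply: eq_bigr => x /negPf xpt; rewrite ffunE xpt.
rewrite (twist_boundary (val z)); split=> [[/ffunP h0 t0]|[bz t0]].
  split=> // x xpt; apply/(homology_class0 (coord z (exist (fun x => x != pt) x xpt))).
  by have := h0 (exist (fun x => x != pt) x xpt); rewrite !ffunE.
congr pair => //; apply/ffunP => x; rewrite !ffunE.
by apply/homology_class0; apply/bz/(valP x).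
Qed.
End TwistedHomology.

(** * Reaching the root of the tree by iteration *)

Section RootedTreeAction.
Variables (E : finType) (I : rel E) (X : finType) (pt : X).
Variable a : pointed_action (trace_monoid I) pt.
Variable f : X -> X.
Hypothesis af : forall x e, a x (tgen I e) = f x.
Variable e0 : E.
Local Notation u := (fun x y => action_graph a x y || action_graph a y x).

(** [e0] keeps the quantifier over generators from being vacuous; the source is not the root, whose
    only candidate edge is the removed loop. *)
Lemma action_graphE x y : action_graph a x y -> f x = y /\ x != pt.
Proof.
move=> /andP[/forallP/(_ e0)/eqP]; rewrite af => <- xpt; split=> //.
by apply: contraNneq xpt => ->; rewrite -(af pt e0) act_pt eqxx.
Qed.

(* Each non-root node has a single outgoing edge, so a simple path that once goes
   against an edge has to do so up to its end, which is then not the root. *)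
Lemma backward_path x y p : f y = x -> path u y p -> uniq (x :: y :: p) ->
  y != pt -> last y p != pt.
Proof.
elim: p x y => [|z p IH] x y //= fy /andP[yz zp] /andP[xyz /andP[yzp uzp]] ypt.
case/orP: yz => /action_graphE[fz zpt].
  by move: xyz; rewrite -fy fz !inE eqxx orbT.
by apply: (IH y z fz zp) => //=; rewrite yzp.
Qed.

(** By [backward_path], a simple path ending at the root never uses an edge backwards, so its steps
    are applications of [f]. *)
Lemma simple_path_root x p : path u x p -> uniq (x :: p) -> last x p = pt ->
  exists k, iter k f x = pt.
Proof.
elim: p x => [|y p IH] x /=; first by move=> _ _ ->; exists 0%N.
move=> /andP[xy yp] xyp lp; case/orP: xy => /action_graphE[fx xpt].
  have [|k kP] := IH y yp _ lp; first by case/andP: xyp.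
  by exists k.+1; rewrite iterSr fx.
by have := backward_path fx yp xyp xpt; rewrite lp eqxx.
Qed.

Lemma rooted_tree_nil : is_rooted_tree (action_graph a) pt ->
  forall x, exists k, iter k f x = pt.
Proof.
move=> [[_ _ conn _] _] x; have /connectP[p xp] := conn x pt.
by case/shortenP: xp => q xq uq _ ptE; apply: simple_path_root xq uq (esym ptE).
Qed.
End RootedTreeAction.

(** Without generators the edge condition would hold vacuously, and a node other than the root would
    carry a loop. *)
Lemma rooted_tree_gen (E : finType) (I : rel E) (X : finType) (pt : X)
    (a : pointed_action (trace_monoid I) pt) :
  (1 < #|X|)%N -> is_rooted_tree (action_graph a) pt -> inhabited E.
Proof.
move=> X1 [[_ irr _ _] _]; have [e _|E0] := pickP E; first by constructor.
have [x xpt] : exists x, x != pt.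
  apply/existsP; apply: contraLR X1; rewrite negb_exists -leqNgt => /forallP X0.
  by apply/card_le1_eqP => x y _ _; rewrite (eqP (negbNE (X0 y))) (eqP (negbNE (X0 x))).
have := irr x; rewrite /action_graph (negPf xpt) /= andbT orbb => /forallP[] e.
by have := E0 e.
Qed.

Theorem theorem2p3 (E : finType) (I : rel E)
    (I_irr : irreflexive I) (I_sym : symmetric I)
    (n : nat) (X : finType) (pt : X) (X_card : #|X| = n.+2)
    (a : pointed_action (trace_monoid I) pt)
    (a_full : acts_fully a)
    (a_tree : is_rooted_tree (action_graph a) pt)
    (P : projective_resolution (const_functor (act_category a) int))
    (s : nat) (s_ge1 : (1 <= s)%N) :
  isomorphic (pset_homology P s)
    ({ffun 'I_n.+1 -> reduced_homology (commuting_complex I) s.-1}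
       * {ffun 'I_(num_commuting I s) -> int})%type.
Proof.
have [e0] : inhabited E by apply: (rooted_tree_gen (a := a)); rewrite ?X_card.
pose f x := a x (tgen I e0).
have af x e : a x (tgen I e) = f x by apply: a_full.
have f_pt : f pt = pt by apply: act_pt.
have f_nil := rooted_tree_nil af e0 a_tree.
apply: isomorphic_trans (derived_colim_unique P (cube_resolution I_irr I_sym a) s) _.
apply: isomorphic_trans (cube_homology I_irr I_sym af s) _.
apply: isomorphic_trans (twist_homology f_pt f_nil (aug_complex (commuting_complex I)) s) _.
(* Degree [s] of the augmented complex is dimension [s - 1], whence [s > 0]. It remains to count the
   nodes off the root and the faces with [s] vertices. *)
case: s s_ge1 => // s _; apply: isomorphic_prod; apply: isomorphic_ffun_card.
  by rewrite card_ord card_sig; have := cardC1 pt; rewrite X_card /= => <-; apply: eq_card.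
rewrite card_ord card_sig; apply: eq_card => A; rewrite [RHS]inE -topredE /=.
by rewrite faceE andbC.
Qed.
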